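(* Let $\mathcal{G}$ be a finite non-abelian simple group and $\theta \in \mathrm{Aut}_{\mathrm{Group}}(\mathcal{G})$ have prime order $p$. Assume that the field $k$ has a primitive $p^{th}$ root of unity. Then there exists a biproduct $A = k[\mathcal{G}] \times k[G]$, where $G$ is cyclic of order $p$, such that: (a) $A$ is a non-trivial semisimple cosemisimple Hopf algebra over $k$. (b) The normal Hopf subalgebras of $A$ are $k1$, $\mathcal{H} = k1 \times k[G]$, and $A$. (c) $\mathcal{H} \simeq k[G]$ and $A/\mathcal{H}^+A \simeq k[\mathcal{G}]$ as Hopf algebras. In particular $A$ is not lower solvable.
   Context: A biproduct $k[\mathcal{G}] \times k[G]$ here means $B \times H$ with $H = k[G]$ and $B = k[\mathcal{G}]$ with its usual $k$-algebra and $k$-coalgebra structure together with a left $H$-module structure and a left $H$-comodule structure $\rho(b) = b_{(-1)} \otimes b_{(0)} \in H \otimes B$ making it a Hopf algebra in the category ${}_H^H\mathcal{YD}$ of left-left Yetter–Drinfel'd modules over $H$. Objects of this category are left $H$-modules and left $H$-comodules $M$ satisfying $h_{(1)}m_{(-1)} \otimes h_{(2)}\cdot m_{(0)} = (h_{(1)}\cdot m)_{(-1)}h_{(2)} \otimes (h_{(1)}\cdot m)_{(0)}$ for all $h \in H$, $m \in M$; morphisms are the module and comodule maps; the braiding is $m \otimes n \mapsto m_{(-1)}\cdot n \otimes m_{(0)}$. $B \times H$ is the Hopf algebra over $k$ on $B \otimes H$ (tensors written $b \times h$) with $(b \times h)(b' \times h') = b(h_{(1)}\cdot b') \times h_{(2)}h'$,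 identity $1 \times 1$, $\Delta(b \times h) = (b_{(1)} \times b_{(2)(-1)}h_{(1)}) \otimes (b_{(2)(0)} \times h_{(2)})$, $\epsilon(b \times h) = \epsilon(b)\epsilon(h)$. $k1 \times k[G]$ is the span of the elements $1 \times g$, $g \in G$; in (b), $k1$ is the span of the identity of $A$. A finite-dimensional Hopf algebra is trivial if it or its dual is a group algebra; otherwise it is non-trivial. A Hopf subalgebra $K$ of a Hopf algebra $A$ with antipode $S$ is normal if $a_{(1)}xS(a_{(2)}) \in K$ and $S(a_{(1)})xa_{(2)} \in K$ for all $a \in A$, $x \in K$. $K^+ = K \cap \mathrm{Ker}(\epsilon)$. A lower normal series for $A$ is a finite chain of Hopf subalgebras $k = A_n \subseteq A_{n-1} \subseteq \cdots \subseteq A_0 = A$ with $A_{i+1}$ normal in $A_i$ for all $i$; its factors are the quotient Hopf algebras $A_i/A_{i+1}^+A_i$. $A$ is lower solvable if it has a lower normal series all of whose factors are commutative.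
   Formalization: The claim that A is semisimple is made only when the order of the group 𝒢 is invertible in k; it is false otherwise (e.g. 𝒢 = A_5, p = 3, k = F_4), since k[𝒢] is a quotient of A. All other claims hold for every k with a primitive p-th root of unity. *)

(* Defs.v *)
From HB Require Import structures.
From mathcomp Require Import all_boot all_order all_algebra.
From mathcomp Require Import all_fingroup all_solvable.

Set Implicit Arguments.
Unset Strict Implicit.
Unset Printing Implicit Defensive.

Import GRing.Theory.
Local Open Scope ring_scope.

(* Tensor products of finite-dimensional spaces, as coordinate matrices over
   the canonical bases.  [tlift f] is the linear map on the tensor product
   induced by [f]; it is only ever used for bilinear [f], and then [tliftE] and
   [tlift_unique] say that it is the map given by the universal property.
   Sweedler notation is an application of [tlift]:
   [\sw_(x1, x2 <- comul x) E] stands for E(x_(1), x_(2)). *)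

Definition tensor (k : fieldType) (U V : vectType k) : vectType k :=
  'M[k]_(\dim {:U}, \dim {:V}).

Definition vbase (k : fieldType) (U : vectType k) (i : 'I_(\dim {:U})) : U :=
  (vbasis {:U})`_i.

Definition vcoord (k : fieldType) (U : vectType k) (i : 'I_(\dim {:U}))
  (u : U) : k^o := coord (vbasis {:U}) i u.

Definition tens (k : fieldType) (U V : vectType k) (u : U) (v : V) :
  tensor U V := \matrix_(i, j) (vcoord i u * vcoord j v).

Definition tlift (k : fieldType) (U V W : vectType k) (f : U -> V -> W) :
  'Hom(tensor U V, W) :=
  linfun (fun t : tensor U V =>
    \sum_(i < \dim {:U}) \sum_(j < \dim {:V})
      (t : 'M[k]_(\dim {:U}, \dim {:V})) i j *: f (vbase i) (vbase j)).

Notation "\sw_ ( x , y <- t ) E" := (tlift (fun x y => E) t)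
  (at level 41, E at level 41, x name, y name, t at level 50,
   format "\sw_ ( x ,  y  <-  t )  E") : ring_scope.

Lemma tlift_sum (k : fieldType) (U V W : vectType k) (f : U -> V -> W) t :
  tlift f t = \sum_(i < \dim {:U}) \sum_(j < \dim {:V})
      (t : 'M[k]_(\dim {:U}, \dim {:V})) i j *: f (vbase i) (vbase j).
Proof.
rewrite /tlift; set F := fun t : _ => _.
have linF : linear F.
  move=> a x y; rewrite /F scaler_sumr -big_split; apply: eq_bigr => i _ /=.
  rewrite scaler_sumr -big_split; apply: eq_bigr => j _ /=.
  by rewrite !mxE scalerDl scalerA.
pose FL := GRing.isLinear.Build _ _ _ _ F linF.
pose FF : {linear tensor U V -> W} := HB.pack F FL.
exact: (lfunE FF t).
Qed.

Lemma vbase_sum (k : fieldType) (U : vectType k) (u : U) :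
  u = \sum_(i < \dim {:U}) vcoord i u *: vbase i.
Proof. exact/coord_vbasis/memvf. Qed.

Lemma vcoord_vbase (k : fieldType) (U : vectType k) (i j : 'I_(\dim {:U})) :
  vcoord i (vbase j) = (i == j)%:R.
Proof. by rewrite /vcoord coord_free ?(basis_free (vbasisP _)) // eq_sym. Qed.

Lemma tliftE (k : fieldType) (U V W : vectType k) (f : U -> V -> W) :
    (forall v, linear (f^~ v)) -> (forall u, linear (f u)) ->
  forall u v, tlift f (tens u v) = f u v.
Proof.
move=> linl linr u v; rewrite tlift_sum.
pose fl w : {linear U -> W} := HB.pack (f^~ w)
  (GRing.isLinear.Build _ _ _ _ (f^~ w) (linl w)).
pose fr w : {linear V -> W} := HB.pack (f w)
  (GRing.isLinear.Build _ _ _ _ (f w) (linr w)).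
rewrite [in RHS](vbase_sum u) -[RHS]/(fl v _) linear_sum.
apply: eq_bigr => i _; rewrite linearZ /= -[f (vbase i) v]/(fr (vbase i) v).
rewrite [in RHS](vbase_sum v) linear_sum scaler_sumr; apply: eq_bigr => j _.
by rewrite linearZ /= scalerA !mxE.
Qed.

Lemma tlift_unique (k : fieldType) (U V W : vectType k)
    (f g : 'Hom(tensor U V, W)) :
  (forall u v, f (tens u v) = g (tens u v)) -> f = g.
Proof.
move=> fg; apply/lfunP => t.
have -> : t = \sum_(i < \dim {:U}) \sum_(j < \dim {:V})
    (t : 'M[k]_(\dim {:U}, \dim {:V})) i j *: tens (vbase i) (vbase j).
  rewrite [LHS](@matrix_sum_delta k).
  apply: eq_bigr => i _; apply: eq_bigr => j _; congr (_ *: _).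
  apply/matrixP => x y; rewrite !mxE !vcoord_vbase -natrM mulnb.
  by congr (_%:R); rewrite !(eq_sym _ i, eq_sym _ j).
rewrite !linear_sum; apply: eq_bigr => i _ /=.
by rewrite !linear_sum; apply: eq_bigr => j _ /=; rewrite !linearZ /= fg.
Qed.

Definition tmap (k : fieldType) (U V U' V' : vectType k)
  (f : 'Hom(U, U')) (g : 'Hom(V, V')) : 'Hom(tensor U V, tensor U' V') :=
  tlift (fun u v => tens (f u) (g v)).

Definition tensv (k : fieldType) (U V : vectType k)
  (K : {vspace U}) (L : {vspace V}) : {vspace tensor U V} :=
  <<[seq tens x y | x <- vbasis K, y <- vbasis L]>>%VS.

(* The data of a finite-dimensional Hopf algebra, without the axioms, so that
   the constructions below are given by their formulas alone.  The same data
   describes a Hopf algebra in a braided category; only the axioms differ. *)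

Record hopfData (k : fieldType) := HopfData {
  hcar :> vectType k;
  hmul : 'Hom(tensor hcar hcar, hcar);
  hone : hcar;
  comul : 'Hom(hcar, tensor hcar hcar);
  counit : 'Hom(hcar, k^o);
  antipode : 'Hom(hcar, hcar) }.

Definition hprod (k : fieldType) (A : hopfData k) (x y : A) : A :=
  hmul A (tens x y).

Notation "x ** y" := (hprod x y) (at level 40, left associativity) : ring_scope.
Notation "1_ A" := (hone A) (at level 8, A at level 2, format "1_ A").

Definition algebra_axioms (k : fieldType) (A : hopfData k) : Prop :=
  [/\ forall x y z : A, x ** (y ** z) = x ** y ** z,
      forall x : A, 1_A ** x = x & forall x : A, x ** 1_A = x].

Definition coalgebra_axioms (k : fieldType) (A : hopfData k) : Prop :=
  [/\ forall x : A,
        \sw_(x1, x2 <- comul A x) \sw_(y, z <- comul A x1) tens y (tens z x2) =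
        \sw_(x1, x2 <- comul A x) tens x1 (comul A x2),
      forall x : A, \sw_(x1, x2 <- comul A x) counit A x1 *: x2 = x &
      forall x : A, \sw_(x1, x2 <- comul A x) counit A x2 *: x1 = x].

Definition counit_multiplicative (k : fieldType) (A : hopfData k) : Prop :=
  (forall x y : A, counit A (x ** y) = counit A x * counit A y) /\
  counit A 1_A = 1.

Definition antipode_axioms (k : fieldType) (A : hopfData k) : Prop :=
  (forall x : A,
     \sw_(x1, x2 <- comul A x) (antipode A x1 ** x2) = counit A x *: 1_A) /\
  (forall x : A,
     \sw_(x1, x2 <- comul A x) (x1 ** antipode A x2) = counit A x *: 1_A).

Definition hopf_axioms (k : fieldType) (A : hopfData k) : Prop :=
  [/\ algebra_axioms A, coalgebra_axioms A,
      (forall x y : A, comul A (x ** y) =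
         \sw_(x1, x2 <- comul A x) \sw_(y1, y2 <- comul A y)
            tens (x1 ** y1) (x2 ** y2)) /\
      comul A 1_A = tens 1_A 1_A,
      counit_multiplicative A & antipode_axioms A].

Definition hopf_morph (k : fieldType) (A B : hopfData k) (f : 'Hom(A, B)) :=
  [/\ (forall x y : A, f (x ** y) = f x ** f y) /\ f 1_A = 1_B,
      forall x : A, comul B (f x) = tmap f f (comul A x),
      forall x : A, counit B (f x) = counit A x &
      forall x : A, antipode B (f x) = f (antipode A x)].

Definition hopf_iso (k : fieldType) (A B : hopfData k) : Prop :=
  exists f : 'Hom(A, B), hopf_morph f /\ bijective f.

Definition commutative_hopf (k : fieldType) (A : hopfData k) : Prop :=
  forall x y : A, x ** y = y ** x.

(* Group algebras: the group element [g] is the indicator function of [g], and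
   the product is convolution. *)

Definition gelt (k : fieldType) (gT : finGroupType) (g : gT) :
  {ffun gT -> k^o} := [ffun x => (x == g)%:R].

Definition group_alg (k : fieldType) (gT : finGroupType) : hopfData k :=
  @HopfData k {ffun gT -> k^o}
    (tlift (fun a b : {ffun gT -> k^o} =>
       [ffun x => \sum_(y : gT) a y * b (y^-1 * x)%g] : {ffun gT -> k^o}))
    (gelt k 1%g)
    (linfun (fun a : {ffun gT -> k^o} =>
       \sum_(g : gT) a g *: tens (gelt k g) (gelt k g)))
    (linfun (fun a : {ffun gT -> k^o} => (\sum_(g : gT) a g) : k^o))
    (linfun (fun a : {ffun gT -> k^o} =>
       [ffun x => a x^-1%g] : {ffun gT -> k^o})).

Definition is_group_alg (k : fieldType) (A : hopfData k) : Prop :=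
  exists gT : finGroupType, hopf_iso A (group_alg k gT).

(* The coproduct of f is the image of (x, y) |-> f (x y) under the
   identification of the dual of A (x) A with the tensor square of the dual. *)

Definition dual_base (k : fieldType) (U : vectType k) (i : 'I_(\dim {:U})) :
  'Hom(U, k^o) := linfun (vcoord i).

Definition hopf_dual (k : fieldType) (A : hopfData k) : hopfData k :=
  @HopfData k 'Hom(A, k^o)
    (tlift (fun f g : 'Hom(A, k^o) =>
       linfun (fun x => \sw_(x1, x2 <- comul A x) (f x1 * g x2 : k^o))))
    (counit A)
    (linfun (fun f : 'Hom(A, k^o) =>
       \sum_(i < \dim {:A}) \sum_(j < \dim {:A})
         f (vbase i ** vbase j) *: tens (dual_base i) (dual_base j)))
    (linfun (fun f : 'Hom(A, k^o) => f 1_A))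
    (linfun (fun f : 'Hom(A, k^o) => (f \o antipode A)%VF)).

Definition trivial_hopf (k : fieldType) (A : hopfData k) : Prop :=
  is_group_alg A \/ is_group_alg (hopf_dual A).

(* Semisimple: the left regular module is a sum of simple submodules.
   Cosemisimple: the coalgebra is the sum of its simple subcoalgebras. *)

Definition left_ideal (k : fieldType) (A : hopfData k) (I : {vspace A}) :=
  forall a x : A, x \in I -> a ** x \in I.

Definition simple_left_ideal (k : fieldType) (A : hopfData k)
    (I : {vspace A}) : Prop :=
  [/\ left_ideal I, I <> 0%VS &
      forall J : {vspace A}, left_ideal J -> (J <= I)%VS -> J = 0%VS \/ J = I].

Definition semisimple (k : fieldType) (A : hopfData k) : Prop :=
  exists s : seq {vspace A},
    (forall I, I \in s -> simple_left_ideal I) /\ (\sum_(I <- s) I = fullv)%VS.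

Definition subcoalgebra (k : fieldType) (A : hopfData k) (C : {vspace A}) :=
  forall x : A, x \in C -> comul A x \in tensv C C.

Definition simple_subcoalgebra (k : fieldType) (A : hopfData k)
    (C : {vspace A}) : Prop :=
  [/\ subcoalgebra C, C <> 0%VS &
      forall D : {vspace A},
        subcoalgebra D -> (D <= C)%VS -> D = 0%VS \/ D = C].

Definition cosemisimple (k : fieldType) (A : hopfData k) : Prop :=
  exists s : seq {vspace A},
    (forall C, C \in s -> simple_subcoalgebra C) /\
    (\sum_(C <- s) C = fullv)%VS.

Definition hopf_subalg (k : fieldType) (A : hopfData k) (K : {vspace A}) :=
  [/\ 1_A \in K,
      forall x y : A, x \in K -> y \in K -> x ** y \in K,
      subcoalgebra K &
      forall x : A, x \in K -> antipode A x \in K].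

(* Meaningful when K is a Hopf subalgebra: [vsproj K] inverts the inclusion on
   K, and the structure maps of A then stabilize K. *)
Definition hopf_sub (k : fieldType) (A : hopfData k) (K : {vspace A}) :
  hopfData k :=
  @HopfData k (subvs_of K)
    (tlift (fun x y : subvs_of K => vsproj K (vsval x ** vsval y)))
    (vsproj K 1_A)
    (tmap (linfun (vsproj K)) (linfun (vsproj K)) \o comul A \o linfun vsval)%VF
    (counit A \o linfun vsval)%VF
    (linfun (vsproj K) \o antipode A \o linfun vsval)%VF.

(* K is normal in the Hopf subalgebra L containing it. *)
Definition normal_in (k : fieldType) (A : hopfData k) (L K : {vspace A}) :=
  forall a x : A, a \in L -> x \in K ->
    \sw_(a1, a2 <- comul A a) (a1 ** x ** antipode A a2) \in K /\
    \sw_(a1, a2 <- comul A a) (antipode A a1 ** x ** a2) \in K.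

Definition normal_hopf_subalg (k : fieldType) (A : hopfData k)
    (K : {vspace A}) : Prop :=
  hopf_subalg K /\ normal_in fullv K.

(* K^+ A, where K^+ is the intersection of K with the kernel of the counit. *)
Definition plus_ideal (k : fieldType) (A : hopfData k) (K : {vspace A}) :
  {vspace A} :=
  <<[seq x ** y | x <- vbasis (K :&: lker (counit A))%VS,
                  y <- vbasis (fullv : {vspace A})]>>%VS.

(* The quotient A / I by a Hopf ideal I.  The quotient space is realized on a
   complement of I; [quot_proj I] is the canonical projection. *)

Definition quot_proj (k : fieldType) (U : vectType k) (I : {vspace U}) :
  'Hom(U, subvs_of I^C%VS) :=
  (linfun (vsproj I^C%VS) \o daddv_pi I^C%VS I)%VF.

Definition hopf_quot (k : fieldType) (A : hopfData k) (I : {vspace A}) :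
  hopfData k :=
  @HopfData k (subvs_of I^C%VS)
    (tlift (fun x y : subvs_of I^C%VS => quot_proj I (vsval x ** vsval y)))
    (quot_proj I 1_A)
    (tmap (quot_proj I) (quot_proj I) \o comul A \o linfun vsval)%VF
    (counit A \o linfun vsval)%VF
    (quot_proj I \o antipode A \o linfun vsval)%VF.

Lemma quot_projE (k : fieldType) (U : vectType k) (I : {vspace U}) (u : U) :
  vsval (quot_proj I u) = daddv_pi I^C%VS I u.
Proof.
by rewrite comp_lfunE lfunE; exact/vsprojK/memv_pi.
Qed.

Lemma lker_quot_proj (k : fieldType) (U : vectType k) (I : {vspace U}) :
  lker (quot_proj I) = I.
Proof.
have capI : (I^C :&: I = 0)%VS by rewrite capvC capv_compl.
apply/vspaceP => u; rewrite memv_ker -(inj_eq val_inj).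
rewrite -[X in X == _]/(vsval _) -[X in _ == X]/(0 : U) quot_projE.
have uE : daddv_pi I^C I u + daddv_pi I I^C u = u.
  by apply: daddv_pi_add => //; rewrite addvC addv_complf memvf.
apply/eqP/idP => [pu0 | uI]; first by rewrite -uE pu0 add0r memv_pi.
by move: uE; rewrite (daddv_pi_id (capv_compl I) uI) => /(canRL (addrK _)) ->;
   rewrite subrr.
Qed.

Lemma quot_projK (k : fieldType) (U : vectType k) (I : {vspace U}) :
  cancel (vsval : subvs_of I^C%VS -> U) (quot_proj I).
Proof.
move=> x; apply: val_inj; rewrite -[LHS]/(vsval _) quot_projE daddv_pi_id ?subvsP //.
by rewrite capvC capv_compl.
Qed.

(* The Hopf algebra L / K^+ L for Hopf subalgebras K <= L of A; here
   [linfun (vsproj L) @: K] is K as a subspace of L. *)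
Definition factor (k : fieldType) (A : hopfData k) (L K : {vspace A}) :
  hopfData k :=
  hopf_quot (plus_ideal (A := hopf_sub L) (linfun (vsproj L) @: K)%VS).

Definition lower_normal_series (k : fieldType) (A : hopfData k)
    (n : nat) (F : nat -> {vspace A}) : Prop :=
  [/\ F 0 = fullv /\ F n = <[1_A]>%VS,
      forall i, (i <= n)%N -> hopf_subalg (F i) &
      forall i, (i < n)%N -> (F i.+1 <= F i)%VS /\ normal_in (F i) (F i.+1)].

Definition lower_solvable (k : fieldType) (A : hopfData k) : Prop :=
  exists (n : nat) (F : nat -> {vspace A}), lower_normal_series n F /\
    forall i, (i < n)%N -> commutative_hopf (factor (F i) (F i.+1)).

Record ydData (k : fieldType) (H : hopfData k) := YDData {
  ycar :> vectType k;
  yact : 'Hom(tensor H ycar, ycar);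
  ycoact : 'Hom(ycar, tensor H ycar) }.

Definition act (k : fieldType) (H : hopfData k) (M : ydData H) (h : H) (m : M) :
  M := yact M (tens h m).

Notation "h |> m" := (act h m) (at level 41, right associativity) : ring_scope.

Definition yd_axioms (k : fieldType) (H : hopfData k) (M : ydData H) : Prop :=
  [/\ (forall (h h' : H) (m : M), h ** h' |> m = h |> h' |> m) /\
      (forall m : M, 1_H |> m = m),
      forall m : M,
        \sw_(h, n <- ycoact M m) \sw_(h1, h2 <- comul H h) tens h1 (tens h2 n) =
        \sw_(h, n <- ycoact M m) tens h (ycoact M n),
      forall m : M, \sw_(h, n <- ycoact M m) counit H h *: n = m &
      forall (h : H) (m : M),
        \sw_(h1, h2 <- comul H h) \sw_(m1, m0 <- ycoact M m)
          tens (h1 ** m1) (h2 |> m0) =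
        \sw_(h1, h2 <- comul H h) \sw_(n1, n0 <- ycoact M (h1 |> m))
          tens (n1 ** h2) n0].

Definition yd_unit (k : fieldType) (H : hopfData k) : ydData H :=
  @YDData k H k^o
    (tlift (fun (h : H) (c : k^o) => counit H h * c : k^o))
    (linfun (fun c : k^o => tens 1_H c)).

Definition yd_tensor (k : fieldType) (H : hopfData k) (M N : ydData H) :
  ydData H :=
  @YDData k H (tensor M N)
    (tlift (fun (h : H) (t : tensor M N) =>
       \sw_(h1, h2 <- comul H h) \sw_(m, n <- t) tens (h1 |> m) (h2 |> n)))
    (tlift (fun (m : M) (n : N) =>
       \sw_(m1, m0 <- ycoact M m) \sw_(n1, n0 <- ycoact N n)
         tens (m1 ** n1) (tens m0 n0))).

Definition yd_morph (k : fieldType) (H : hopfData k) (M N : ydData H)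
    (f : 'Hom(M, N)) : Prop :=
  (forall (h : H) (m : M), f (h |> m) = h |> f m) /\
  (forall m : M, ycoact N (f m) = \sw_(h, m0 <- ycoact M m) tens h (f m0)).

Definition braiding (k : fieldType) (H : hopfData k) (M N : ydData H) :
  'Hom(tensor M N, tensor N M) :=
  tlift (fun m n => \sw_(m1, m0 <- ycoact M m) tens (m1 |> n) m0).

(* The data B, with the action and coaction given by [yact] and [ycoact], is a
   Hopf algebra in the category of Yetter-Drinfel'd modules over H.  The
   coproduct is multiplicative for the product
   (a (x) b)(c (x) d) = a c' (x) b' d, with c' (x) b' the braiding of b (x) c. *)
Definition yd_hopf (k : fieldType) (H B : hopfData k)
    (yact : 'Hom(tensor H B, B)) (ycoact : 'Hom(B, tensor H B)) : Prop :=
  let M := YDData yact ycoact in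
  [/\ yd_axioms M,
      algebra_axioms B /\ coalgebra_axioms B,
      [/\ @yd_morph k H (yd_tensor M M) M (hmul B),
          @yd_morph k H (yd_unit H) M (linfun (fun c : k^o => c *: 1_B)),
          @yd_morph k H M (yd_tensor M M) (comul B),
          @yd_morph k H M (yd_unit H) (counit B) &
          @yd_morph k H M M (antipode B)],
      (forall x y : B, comul B (x ** y) =
         \sw_(x1, x2 <- comul B x) \sw_(y1, y2 <- comul B y)
           \sw_(z, w <- braiding M M (tens x2 y1))
             tens (x1 ** z) (w ** y2)) /\
      comul B 1_B = tens 1_B 1_B &
      counit_multiplicative B /\ antipode_axioms B].

(* The biproduct B x H.  Its antipode is
   S(b x h) = (1 x S_H(b_(-1) h)) (S_B(b_(0)) x 1). *)

Section Biproduct.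

Variables (k : fieldType) (H B : hopfData k).
Variables (yact : 'Hom(tensor H B, B)) (ycoact : 'Hom(B, tensor H B)).

Definition bi_mul : 'Hom(tensor (tensor B H) (tensor B H), tensor B H) :=
  tlift (fun s t : tensor B H => \sw_(b, h <- s) \sw_(b', h' <- t)
    \sw_(h1, h2 <- comul H h) tens (b ** yact (tens h1 b')) (h2 ** h')).

Definition bi_comul : 'Hom(tensor B H, tensor (tensor B H) (tensor B H)) :=
  tlift (fun b h => \sw_(b1, b2 <- comul B b) \sw_(h1, h2 <- comul H h)
    \sw_(c, b0 <- ycoact b2) tens (tens b1 (c ** h1)) (tens b0 h2)).

Definition bi_counit : 'Hom(tensor B H, k^o) :=
  tlift (fun b h => counit B b * counit H h : k^o).

Definition bi_antipode : 'Hom(tensor B H, tensor B H) :=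
  tlift (fun b h => \sw_(c, b0 <- ycoact b)
    bi_mul (tens (tens 1_B (antipode H (c ** h)))
                 (tens (antipode B b0) 1_H))).

Definition biproduct : hopfData k :=
  @HopfData k (tensor B H) bi_mul (tens 1_B 1_H) bi_comul bi_counit bi_antipode.

End Biproduct.

(* Main.v *)
From HB Require Import structures.
From Stdlib Require Import Classical_Prop.
Require Import Defs.
From mathcomp Require Import all_boot all_order all_algebra.
From mathcomp Require Import all_fingroup all_solvable.
Set Implicit Arguments.
Unset Strict Implicit.
Unset Printing Implicit Defensive.
Import GRing.Theory.
Local Open Scope ring_scope.

(** Write N for the simple group and H = k[G] with G = Z/p. The usual coproduct
of k[N] is multiplicative for the flip, so the braiding of k[N] with itself has
to be the flip, and as p is prime either the coaction or the action is trivial.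
A trivial coaction would only give the group algebra of a semidirect product;
here the action is trivial, and the coaction is the grading of k[N] by the
eigenspaces of theta, which exists because k contains the p-th roots of unity:
rho(b) = sum_j eps_j (x) theta^j(b), where the eps_j are the primitive
idempotents of k[Z/p].

All claims are read off the basis e(b, i) = b x eps_i of A, for b in N and i in
Z/p, on which
  e(b, i) e(c, j) = [i = j] e(bc, i),
  Delta e(b, i) = sum_a e(b, a) (x) e(theta^a b, i - a),
  eps e(b, i) = [i = 0],   S e(b, i) = e((theta^i b)^-1, -i)
([cosmash_basis], [biproduct_cosmash_basis]). These formulas give the Hopf
axioms ([cosmash_hopf]). As an algebra A is a product of p copies of k[N]: it is
not commutative, and it has a separability idempotent as soon as |N| is
invertible ([cosmash_separable]). As a coalgebra A is the sum over the orbits of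
theta of a p x p matrix coalgebra for each orbit of size p and of p group-like
elements b x g for each fixed point b: it is cosemisimple
([cosmash_cosemisimple]) and, as theta is not the identity, not cocommutative.
A group algebra is cocommutative, and A would be commutative if its dual were
one; so A is not trivial ([cosmash_nontrivial]).

Let K be a normal Hopf subalgebra. Being a subcoalgebra, K is stable under the
left and right actions of the dual of A, and these project K to the subspaces
spanned by e(c, i), i in Z/p. The c for which this projection of K is nonzero
form a subgroup of N, because e(c, i) e(d, i) = e(cd, i), and it is normal,
because the adjoint action of e(b, 0) moves e(c, i) to e(b c b^-1, i). If it is
trivial then K lies in 1 x k[G], whose only Hopf subalgebras are k1 and itself
since p is prime. If it is N, then K contains e(b, l) and e(b^-1, l) for some b
moved by theta, hence their product e(1, l), hence everything
([cosmash_normal_subalg]).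

The map e(b, i) |-> [i = 0] b is a surjective Hopf algebra map from A to k[N]
with kernel (1 x k[G])^+ A ([cosmash_quot_iso]). The first proper term of a lower
normal series is contained in 1 x k[G], so the factor above it maps onto k[N],
which is not commutative ([cosmash_not_solvable]). *)

(** * Linear maps on tensor products *)

Section Linearity.
Variable k : fieldType.
Implicit Types U V W X : vectType k.

Lemma lin_id U : linear (fun x : U => x).
Proof. by []. Qed.

Lemma lin_hom U V W (h : 'Hom(V, W)) (f : U -> V) :
  linear f -> linear (fun x => h (f x)).
Proof. by move=> lf a x y; rewrite lf linearP. Qed.

Lemma lin_scaler U V (c : k) (f : U -> V) :
  linear f -> linear (fun x => c *: f x).
Proof. by move=> lf a x y; rewrite lf scalerDr !scalerA mulrC. Qed.

Lemma lin_scalel U V (f : U -> k^o) (v : V) :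
  linear f -> linear (fun x => (f x : k) *: v).
Proof. by move=> lf a x y; rewrite lf scalerDl scalerA. Qed.

Lemma lin_mulr U (c : k) (f : U -> k^o) :
  linear f -> linear (fun x => c * f x : k^o).
Proof. exact: (@lin_scaler U k^o). Qed.

Lemma lin_mull U (f : U -> k^o) (c : k^o) :
  linear f -> linear (fun x => (f x : k^o) * c : k^o).
Proof. exact: (@lin_scalel U k^o). Qed.

Lemma lin_sum U V (I : finType) (f : I -> U -> V) :
  (forall i, linear (f i)) -> linear (fun x => \sum_i f i x).
Proof.
move=> lf a x y; rewrite scaler_sumr -big_split.
by apply: eq_bigr => i _; rewrite lf.
Qed.

Lemma lin_vcoord U (i : 'I_(\dim {:U})) : linear (vcoord i).
Proof. by move=> a x y; rewrite /vcoord linearP. Qed.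

Lemma lin_tensl U V W (f : U -> V) (w : W) :
  linear f -> linear (fun x => tens (f x) w).
Proof.
move=> lf a x y; apply/matrixP => i j.
by rewrite !mxE lf lin_vcoord mulrDl mulrA.
Qed.

Lemma lin_tensr U V W (v : V) (f : U -> W) :
  linear f -> linear (fun x => tens v (f x)).
Proof.
move=> lf a x y; apply/matrixP => i j.
by rewrite !mxE lf lin_vcoord mulrDr mulrCA.
Qed.

Lemma lin_tlift U V W X (f : U -> V -> W -> X) (t : tensor V W) :
  (forall v w, linear (fun x => f x v w)) ->
  linear (fun x => tlift (f x) t).
Proof.
move=> lf a x y; rewrite !tlift_sum scaler_sumr -big_split.
apply: eq_bigr => i _; rewrite scaler_sumr -big_split; apply: eq_bigr => j _.
by rewrite lf scalerDr !scalerA mulrC.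
Qed.

Lemma lin_prodl U (A : hopfData k) (f : U -> A) (y : A) :
  linear f -> linear (fun x => f x ** y).
Proof. by move=> lf; exact/lin_hom/lin_tensl. Qed.

Lemma lin_prodr U (A : hopfData k) (y : A) (f : U -> A) :
  linear f -> linear (fun x => y ** f x).
Proof. by move=> lf; exact/lin_hom/lin_tensr. Qed.

Lemma lin_actl U (H : hopfData k) (M : ydData H) (f : U -> H) (m : M) :
  linear f -> linear (fun x => f x |> m).
Proof. by move=> lf; exact/lin_hom/lin_tensl. Qed.

Lemma lin_actr U (H : hopfData k) (M : ydData H) (h : H) (f : U -> M) :
  linear f -> linear (fun x => h |> f x).
Proof. by move=> lf; exact/lin_hom/lin_tensr. Qed.

Lemma lin_vsval U V (K : {vspace V}) (f : U -> subvs_of K) :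
  linear f -> linear (fun x => vsval (f x)).
Proof. by move=> lf a x y; rewrite lf linearP. Qed.

Lemma lin_vsproj U V (K : {vspace V}) (f : U -> V) :
  linear f -> linear (fun x => vsproj K (f x)).
Proof. by move=> lf a x y; rewrite lf linearP. Qed.

Lemma lin_ffun U (T : finType) (f : U -> {ffun T -> k^o}) (t : T) :
  linear f -> linear (fun x => f x t).
Proof. by move=> lf a x y; rewrite lf !ffunE. Qed.

Lemma lin_eval U V W (f : U -> 'Hom(V, W)) (v : V) :
  linear f -> linear (fun x => f x v).
Proof. by move=> lf a x y; rewrite lf add_lfunE scale_lfunE. Qed.

End Linearity.

(** Discharges the bilinearity side conditions of [tliftE] and the linearity of
    Sweedler expressions by recursion on the term: [lin_tlift] handles a variable
    occurring under the binders of a Sweedler sum, the other lemmas a variable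
    occurring in exactly one argument. *)
Ltac lin :=
  intros; cbv beta;
  first
    [ exact: lin_id
    | apply: lin_sum; lin
    | apply: lin_tlift; lin
    | apply: lin_tensl; lin
    | apply: lin_tensr; lin
    | apply: lin_prodl; lin
    | apply: lin_prodr; lin
    | apply: lin_actl; lin
    | apply: lin_actr; lin
    | apply: lin_mull; lin
    | apply: lin_mulr; lin
    | apply: lin_scalel; lin
    | apply: lin_scaler; lin
    | apply: lin_hom; lin
    | apply: lin_vsval; lin
    | apply: lin_vsproj; lin
    | apply: lin_ffun; lin
    | apply: lin_eval; lin ].

Section TensorSums.
Variable k : fieldType.
Implicit Types U V W : vectType k.

Lemma sw_sum U V W (I : finType) (P : pred I) (f : U -> V -> W) (u : I -> U) (v : I -> V) :
  (forall v, linear (f^~ v)) -> (forall u, linear (f u)) ->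
  tlift f (\sum_(i | P i) tens (u i) (v i)) = \sum_(i | P i) f (u i) (v i).
Proof.
by move=> fl fr; rewrite linear_sum; apply: eq_bigr => i _ /=; rewrite tliftE.
Qed.

Definition spanning U (I : finType) (e : I -> U) :=
  forall x, exists c : I -> k, x = \sum_i c i *: e i.

Lemma linear_sumE U V (f : U -> V) (I : finType) (P : pred I) (u : I -> U) :
  linear f -> f (\sum_(i | P i) u i) = \sum_(i | P i) f (u i).
Proof.
move=> lf; pose g : {linear U -> V} :=
  HB.pack f (GRing.isLinear.Build _ _ _ _ f lf).
exact: (linear_sum g).
Qed.

Lemma linear_scaleE U V (f : U -> V) (c : k) (u : U) :
  linear f -> f (c *: u) = c *: f u.
Proof.
move=> lf; pose g : {linear U -> V} :=
  HB.pack f (GRing.isLinear.Build _ _ _ _ f lf).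
by rewrite -[LHS]/(g _) linearZ.
Qed.

Lemma spanning_ext U V (I : finType) (e : I -> U) (f g : U -> V) :
  spanning e -> linear f -> linear g -> (forall i, f (e i) = g (e i)) ->
  forall x, f x = g x.
Proof.
move=> se lf lg fg x; have [c ->] := se x.
rewrite !linear_sumE //; apply: eq_bigr => i _.
by rewrite !linear_scaleE // fg.
Qed.

Lemma tens_sumr U V (I : finType) (P : pred I) (u : U) (v : I -> V) :
  tens u (\sum_(i | P i) v i) = \sum_(i | P i) tens u (v i).
Proof. by rewrite linear_sumE //; lin. Qed.

Lemma tens_suml U V (I : finType) (P : pred I) (u : I -> U) (v : V) :
  tens (\sum_(i | P i) u i) v = \sum_(i | P i) tens (u i) v.
Proof.
by rewrite -[LHS]/((fun x => tens x v) _) linear_sumE //; lin.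
Qed.

Lemma tensZl U V (c : k) (u : U) (v : V) : tens (c *: u) v = c *: tens u v.
Proof. by apply/matrixP=> i j; rewrite !mxE /vcoord linearZ /= mulrA. Qed.

Lemma tensZr U V (c : k) (u : U) (v : V) : tens u (c *: v) = c *: tens u v.
Proof. by apply/matrixP=> i j; rewrite !mxE /vcoord linearZ /= mulrCA. Qed.

Lemma tens0l U V (v : V) : tens (0 : U) v = 0.
Proof. by rewrite -(scale0r 0) tensZl scale0r. Qed.

Lemma tens0r U V (u : U) : tens u (0 : V) = 0.
Proof. by rewrite -(scale0r 0) tensZr scale0r. Qed.

Lemma prodZl (A : hopfData k) (c : k) (x y : A) : (c *: x) ** y = c *: (x ** y).
Proof. by rewrite /hprod tensZl linearZ. Qed.

Lemma prodZr (A : hopfData k) (c : k) (x y : A) : x ** (c *: y) = c *: (x ** y).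
Proof. by rewrite /hprod tensZr linearZ. Qed.

Lemma prod_suml (A : hopfData k) (I : finType) (P : pred I) (x : I -> A) (y : A) :
  (\sum_(i | P i) x i) ** y = \sum_(i | P i) (x i ** y).
Proof. by rewrite /hprod tens_suml linear_sum. Qed.

Lemma prod_sumr (A : hopfData k) (I : finType) (P : pred I) (x : A) (y : I -> A) :
  x ** (\sum_(i | P i) y i) = \sum_(i | P i) (x ** y i).
Proof. by rewrite /hprod tens_sumr linear_sum. Qed.

Lemma sum_delta V (I : finType) (j : I) (F : I -> V) :
  \sum_i (i == j)%:R *: F i = F j.
Proof.
rewrite (bigD1 j) //= eqxx scale1r big1 ?addr0 // => i /negPf ->.
by rewrite scale0r.
Qed.

End TensorSums.

Section TensorMaps.
Variable k : fieldType.
Implicit Types U V W : vectType k.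

Lemma linfunE U V (f : U -> V) (u : U) : linear f -> linfun f u = f u.
Proof.
move=> lf; pose g : {linear U -> V} :=
  HB.pack f (GRing.isLinear.Build _ _ _ _ f lf).
exact: (lfunE g u).
Qed.

Lemma eq_tlift U V W (f g : U -> V -> W) t :
  (forall u v, f u v = g u v) -> tlift f t = tlift g t.
Proof.
by move=> fg; rewrite !tlift_sum; do 2 (apply: eq_bigr => ? _); rewrite fg.
Qed.

Lemma tlift_comp U V W W' (h : 'Hom(W, W')) (f : U -> V -> W) t :
  h (tlift f t) = tlift (fun u v => h (f u v)) t.
Proof.
rewrite !tlift_sum linear_sum; apply: eq_bigr => i _.
by rewrite linear_sum; apply: eq_bigr => j _; rewrite linearZ.
Qed.

Lemma tmap_tens U V U' V' (f : 'Hom(U, U')) (g : 'Hom(V, V')) u v :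
  tmap f g (tens u v) = tens (f u) (g v).
Proof. by rewrite /tmap tliftE //; lin. Qed.

Lemma tlift_tmap U V U' V' W (f : 'Hom(U, U')) (g : 'Hom(V, V'))
    (h : U' -> V' -> W) t :
  (forall v, linear (h^~ v)) -> (forall u, linear (h u)) ->
  tlift h (tmap f g t) = tlift (fun u v => h (f u) (g v)) t.
Proof.
move=> hl hr; rewrite /tmap tlift_comp; apply: eq_tlift => u v.
by rewrite tliftE.
Qed.

Lemma tmap_tmap U V U' V' U'' V'' (f : 'Hom(U, U')) (g : 'Hom(V, V'))
    (f' : 'Hom(U', U'')) (g' : 'Hom(V', V'')) t :
  tmap f' g' (tmap f g t) = tmap (f' \o f)%VF (g' \o g)%VF t.
Proof.
rewrite {1}/tmap tlift_tmap; [|lin|lin].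
by apply: eq_tlift => u v; rewrite !comp_lfunE.
Qed.

Lemma tlift_tens U V (t : tensor U V) : tlift (@tens k U V) t = t.
Proof.
have -> : tlift (@tens k U V) = \1%VF; last exact: id_lfunE.
by apply: tlift_unique => u v; rewrite tliftE ?id_lfunE //; lin.
Qed.

Lemma tmap_id U V (f : 'Hom(U, U)) (g : 'Hom(V, V)) t :
  f =1 id -> g =1 id -> tmap f g t = t.
Proof.
move=> f1 g1; rewrite -[RHS]tlift_tens; apply: eq_tlift => u v.
by rewrite f1 g1.
Qed.

Lemma span_image U W (s : seq U) (K : {vspace W}) (h : 'Hom(U, W)) u :
  (forall x, x \in s -> h x \in K) -> u \in <<s>>%VS -> h u \in K.
Proof.
move=> sK; rewrite memv_preim; apply: subvP.
by apply/span_subvP => x /sK; rewrite -memv_preim.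
Qed.

Lemma span_ext U W (s : seq U) (f g : U -> W) :
  linear f -> linear g -> (forall x, x \in s -> f x = g x) ->
  forall x, x \in <<s>>%VS -> f x = g x.
Proof.
move=> lf lg fg x xs; apply/eqP; rewrite -subr_eq0 -memv0.
have := @span_image _ _ s 0%VS (linfun f - linfun g)%R x.
rewrite add_lfunE opp_lfunE !linfunE //; apply=> // y /fg fgy.
by rewrite add_lfunE opp_lfunE !linfunE // fgy subrr mem0v.
Qed.

Lemma tensv_image U V W (K : {vspace U}) (L : {vspace V}) (M : {vspace W})
    (h : 'Hom(tensor U V, W)) t :
  (forall u v, u \in K -> v \in L -> h (tens u v) \in M) ->
  t \in tensv K L -> h t \in M.
Proof.
move=> hM; apply: span_image => _ /allpairsP [[u v] [/= uK vL ->]].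
by apply: hM; exact: vbasis_mem.
Qed.

Lemma vbasis_sum U (K : {vspace U}) u :
  u \in K -> exists c : 'I_(\dim K) -> k, u = \sum_i c i *: (vbasis K)`_i.
Proof.
by move=> uK; exists (fun i => coord (vbasis K) i u); exact: coord_vbasis.
Qed.

Lemma tens_mem U V (K : {vspace U}) (L : {vspace V}) u v :
  u \in K -> v \in L -> tens u v \in tensv K L.
Proof.
move=> /vbasis_sum [c ->] /vbasis_sum [d ->].
rewrite tens_suml memv_suml // => i _; rewrite tens_sumr memv_suml // => j _.
rewrite tensZl tensZr !memvZ // memv_span //; apply: allpairs_f;
  by rewrite mem_nth // size_tuple.
Qed.

(** Hence the whole algebra is a subcoalgebra of itself. *)
Lemma tensv_full U V (t : tensor U V) : t \in tensv fullv fullv.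
Proof.
rewrite -[t]tlift_tens tlift_sum memv_suml // => i _; rewrite memv_suml // => j _.
by rewrite memvZ // tens_mem ?memvf.
Qed.

End TensorMaps.

Lemma tens_ext (k : fieldType) (U V W : vectType k) (I J : finType)
    (e : I -> U) (f : J -> V) (g h : tensor U V -> W) :
  spanning e -> spanning f -> linear g -> linear h ->
  (forall i j, g (tens (e i) (f j)) = h (tens (e i) (f j))) ->
  forall t, g t = h t.
Proof.
move=> se sf lg lh gh t; rewrite -(linfunE t lg) -(linfunE t lh).
suff -> : linfun g = linfun h by [].
apply: tlift_unique => u v; move: u; apply: (spanning_ext se); [lin|lin|move=> i].
move: v; apply: (spanning_ext sf); [lin|lin|move=> j].
by rewrite !linfunE.
Qed.

(** * Hopf subalgebras, quotients and commutativity *)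

Lemma vsval_quot_proj (k : fieldType) (U V : vectType k) (I : {vspace U}) (h : 'Hom(U, V)) u :
  (I <= lker h)%VS -> h (vsval (quot_proj I u)) = h u.
Proof.
move=> Ik; apply/eqP; rewrite -subr_eq0 -linearB /= -memv_ker.
have : vsval (quot_proj I u) - u \in lker (quot_proj I).
  by rewrite memv_ker linearB /= quot_projK subrr.
by rewrite lker_quot_proj; apply: subvP.
Qed.

Section HopfIsomorphisms.
Variables (k : fieldType) (A B : hopfData k) (f : 'Hom(A, B)).
Hypothesis fM : hopf_morph f.

(** The structure maps of [hopf_sub K] are those of [B] transported by
    [vsproj K], which inverts the inclusion on the image [K] of [f]; so the
    inverse of [f] is a morphism. *)
Lemma inj_hopf_sub_iso (K : {vspace B}) :
  lker f = 0%VS -> limg f = K -> hopf_iso (hopf_sub K) A.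
Proof.
move=> kf imf; have [[f_mul f1] f_com f_cou f_ant] := fM.
have fK : cancel f (f^-1)%VF by apply/lker0_lfunK/eqP.
have vK (x : A) : vsval (vsproj K (f x)) = f x.
  by rewrite vsprojK // -imf memv_img ?memvf.
have valP' (x : subvs_of K) : exists y, x = vsproj K (f y).
  have := subvsP x; rewrite -{2}imf => /memv_imgP [y _ xy].
  by exists y; rewrite -xy vsvalK.
pose h : 'Hom(subvs_of K, A) := (f^-1 \o linfun vsval)%VF.
have hE y : h (vsproj K (f y)) = y by rewrite comp_lfunE lfunE /= vK fK.
exists h; split; last first.
  exists (fun y => vsproj K (f y)) => x; last exact: hE.
  by have [y ->] := valP' x; rewrite hE.
split.
- split=> [x y|]; last by rewrite /= -f1 hE.
  have [x' ->] := valP' x; have [y' ->] := valP' y; rewrite !hE.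
  rewrite -[_ ** _ in LHS]/(tlift _ _) tliftE; first last.
  + by lin.
  + by lin.
  by rewrite !vK -f_mul hE.
- move=> x; have [y ->] := valP' x; rewrite hE.
  rewrite /= !comp_lfunE lfunE /= vK f_com !tmap_tmap tmap_id // => z;
    by rewrite /h !comp_lfunE !lfunE /= vK fK.
- by move=> x; have [y ->] := valP' x; rewrite hE /= !comp_lfunE lfunE /= vK f_cou.
move=> x; have [y ->] := valP' x; rewrite hE /= !comp_lfunE !lfunE /= vK f_ant.
by rewrite vK fK.
Qed.

(** [quot_proj I] picks representatives modulo [I], and [f] does not see the
    choice; so [f], restricted to the complement carrying the quotient, is a
    morphism, and it is injective there. *)
Lemma surj_hopf_quot_iso (I : {vspace A}) :
  lker f = I -> limg f = fullv -> hopf_iso (hopf_quot I) B.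
Proof.
move=> kf imf; have [[f_mul f1] f_com f_cou f_ant] := fM.
have qK u : f (vsval (quot_proj I u)) = f u.
  by apply: vsval_quot_proj; rewrite kf.
pose h : 'Hom(subvs_of I^C%VS, B) := (f \o linfun vsval)%VF.
have hE x : h x = f (vsval x) by rewrite /h comp_lfunE lfunE.
have kh : lker h == 0%VS.
  rewrite -subv0; apply/subvP => x; rewrite memv_ker hE -memv_ker kf => xI.
  rewrite memv0 -(inj_eq val_inj) /=.
  by rewrite -memv0 -(capv_compl I) memv_cap xI subvsP.
exists h; split; last first.
  exists (fun y => (h^-1)%VF y) => [|y]; first exact: lker0_lfunK.
  have /memv_imgP [x _ ->] : y \in limg f by rewrite imf memvf.
  by rewrite -qK -hE lker0_lfunK.
split.
- split=> [x y|]; last by rewrite hE qK.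
  rewrite !hE -[_ ** _ in LHS]/(tlift _ _) tliftE; [|lin|lin].
  by rewrite qK f_mul.
- move=> x; rewrite hE f_com /= !comp_lfunE lfunE tmap_tmap /=.
  apply: eq_tlift => u v.
  by rewrite ![(h \o _)%VF _]comp_lfunE !hE !qK.
- by move=> x; rewrite hE f_cou /= comp_lfunE lfunE.
move=> x; have vE : linfun vsval x = vsval x by rewrite lfunE.
by rewrite !hE f_ant /= [((_ \o _) \o _)%VF x]comp_lfunE comp_lfunE vE qK.
Qed.

End HopfIsomorphisms.

Section Commutativity.
Variable k : fieldType.
Implicit Types A B : hopfData k.

Definition cocommutative A :=
  forall x : A, \sw_(x1, x2 <- comul A x) tens x2 x1 = comul A x.

(** The tensor square of an isomorphism is invertible and commutes with the
    flip. *)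
Lemma hopf_iso_cocommutative A B :
  hopf_iso A B -> cocommutative B -> cocommutative A.
Proof.
move=> [f [[_ fC _ _] /bij_inj f_inj]] cB x.
have fK : cancel f (f^-1)%VF.
  by apply/lker0_lfunK; apply/lker0P.
have tK t : tmap f^-1 f^-1 (tmap f f t) = t.
  by rewrite tmap_tmap tmap_id // => z; rewrite comp_lfunE fK.
rewrite -[LHS]tK -[RHS]tK; congr (tmap _ _ _).
rewrite -fC -[RHS]cB fC [in RHS]tlift_tmap; [|lin|lin].
by rewrite tlift_comp; apply: eq_tlift => u v; rewrite tmap_tens.
Qed.

(** Evaluating the coproduct of [f] at [(x, y)] gives [f (x ** y)], so a
    symmetric coproduct makes every functional take the same value on [x ** y]
    and on [y ** x]. *)
Lemma dual_cocommutative A :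
  cocommutative (hopf_dual A) -> commutative_hopf A.
Proof.
move=> cA x y.
have ev (f : 'Hom(A, k^o)) (x' y' : A) :
    tlift (fun u v : 'Hom(A, k^o) => u x' * v y' : k^o)
      (comul (hopf_dual A) f) = f (x' ** y').
  rewrite [X in tlift _ X]linfunE; last by lin.
  rewrite linear_sum.
  rewrite {2}(vbase_sum x') {2}(vbase_sum y') prod_suml linear_sum.
  apply: eq_bigr => i _; rewrite !linear_sum prod_sumr linear_sum.
  apply: eq_bigr => j _; rewrite linearZ /= tliftE; [|lin|lin].
  rewrite prodZl prodZr !linearZ /= !linfunE; try exact: lin_vcoord.
  by congr (_ *: _); exact: mulrC.
have fxy (f : 'Hom(A, k^o)) : f (x ** y) = f (y ** x).
  rewrite -!ev -[X in tlift _ X = _]cA tlift_comp; apply: eq_tlift => u v.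
  by rewrite tliftE; [rewrite mulrC|lin|lin].
rewrite [LHS]vbase_sum [RHS]vbase_sum; apply: eq_bigr => i _.
have := fxy (dual_base i); rewrite !linfunE; try exact: lin_vcoord.
by move=> ->.
Qed.

Lemma quot_commutative A B (I : {vspace A}) (f : 'Hom(A, B)) :
  (forall x y, f (x ** y) = f x ** f y) -> limg f = fullv ->
  (I <= lker f)%VS -> commutative_hopf (hopf_quot I) -> commutative_hopf B.
Proof.
move=> fM imf If cQ x y.
have /memv_imgP [a _ ->] : x \in limg f by rewrite imf memvf.
have /memv_imgP [b _ ->] : y \in limg f by rewrite imf memvf.
have qK u : f (vsval (quot_proj I u)) = f u by exact: vsval_quot_proj.
have := cQ (quot_proj I a) (quot_proj I b).
rewrite -[_ ** _ in LHS]/(tlift _ _) tliftE; [|lin|lin].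
rewrite -[_ ** _ in RHS]/(tlift _ _) tliftE; [|lin|lin].
by move/(congr1 (fun z => f (vsval z))); rewrite !qK !fM !qK.
Qed.

(** [f] factors through the quotient by the ideal generated by the augmentation
    ideal of [K], and multiplicative surjections transport commutativity. *)
Lemma factor_commutative A B (K : {vspace A}) (f : 'Hom(A, B)) :
  (forall x y, f (x ** y) = f x ** f y) -> limg f = fullv ->
  (forall x, x \in K -> counit A x = 0 -> f x = 0) ->
  commutative_hopf (factor fullv K) -> commutative_hopf B.
Proof.
move=> fM imf fK.
pose h : 'Hom(hopf_sub (fullv : {vspace A}), B) := (f \o linfun vsval)%VF.
have hE x : h x = f (vsval x) by rewrite /h comp_lfunE lfunE.
have hM x y : h (x ** y) = h x ** h y.
  rewrite -[_ ** _ in LHS]/(tlift _ _) tliftE; [|lin|lin].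
  by rewrite !hE vsprojK ?memvf // fM.
apply: (@quot_commutative _ _ _ h) => //.
  apply/vspaceP => y; rewrite memvf.
  have /memv_imgP [a _ ->] : y \in limg f by rewrite imf memvf.
  by rewrite -[a](@vsprojK _ _ fullv) ?memvf // -hE memv_img ?memvf.
apply/span_subvP => _ /allpairsP [[u v] [/= uK _ ->]].
rewrite memv_ker hM; suff -> : h u = 0 by rewrite /hprod tens0l linear0.
have := vbasis_mem uK; rewrite memv_cap => /andP [/memv_imgP [a aK ->]].
rewrite (linfunE _ (lin_vsproj fullv (@lin_id _ _))) hE memv_ker /= comp_lfunE.
rewrite (linfunE _ (lin_vsval (@lin_id _ _))) vsprojK ?memvf // => /eqP.
exact: fK.
Qed.

End Commutativity.

(** * Separable algebras are semisimple *)

Section Semisimple.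
Variables (k : fieldType) (A : hopfData k).

Lemma left_ideal_full : left_ideal (fullv : {vspace A}).
Proof. by move=> *; exact: memvf. Qed.

Lemma left_ideal_cap (I J : {vspace A}) :
  left_ideal I -> left_ideal J -> left_ideal (I :&: J)%VS.
Proof.
move=> lI lJ a x; rewrite !memv_cap => /andP [xI xJ].
by rewrite lI ?lJ.
Qed.

(** Induction on the dimension: a left ideal that is not simple contains a
    smaller nonzero one, and by the modular law a complement of the latter in
    the whole algebra cuts out a complement inside the former. Simplicity over
    an infinite field is not decidable, whence the classical case split. *)
Lemma complemented_semisimple :
  (forall I : {vspace A}, left_ideal I -> exists J : {vspace A},
     [/\ left_ideal J, (I + J = fullv)%VS & (I :&: J = 0)%VS]) ->
  semisimple A.
Proof.
move=> compl.
suff dec n (I : {vspace A}) : (\dim I <= n)%N -> left_ideal I ->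
    exists s : seq {vspace A},
    (forall J, J \in s -> simple_left_ideal J) /\ (\sum_(J <- s) J = I)%VS.
  exact: dec (leqnn _) left_ideal_full.
elim: n I => [|n IH] I dI lI.
  exists [::]; split=> //; rewrite big_nil; apply/esym/eqP.
  by rewrite -dimv_eq0 -leqn0.
have [I0|I0] := eqVneq I 0%VS.
  by exists [::]; split=> //; rewrite big_nil I0.
case: (classic (exists J : {vspace A},
    [/\ left_ideal J, (J <= I)%VS, J != 0%VS & J != I])) => [|nJ]; last first.
  exists [:: I]; rewrite big_seq1; split=> // J; rewrite inE => /eqP ->.
  split=> //; first exact/eqP.
  move=> J' lJ' sJ'; case: (eqVneq J' 0%VS) => [|J'0]; [by left|right].
  by apply/eqP/negPn/negP => J'I; apply: nJ; exists J'.
move=> [J [lJ sJI J0 JI]]; have [C [lC JC JC0]] := compl J lJ.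
have dJ : (\dim J < \dim I)%N.
  by rewrite (ltn_leqif (dimv_leqif_eq sJI)).
pose C' := (C :&: I)%VS.
have lC' : left_ideal C' by exact: left_ideal_cap.
have JC'0 : (J :&: C' = 0)%VS.
  by apply/eqP; rewrite -subv0 -JC0 capvS // capvSl.
have JC' : (J + C' = I)%VS.
  apply/eqP; rewrite eqEsubv subv_add sJI capvSr /=; apply/subvP => x xI.
  have /memv_addP [a aJ [b bC xab]] : x \in (J + C)%VS by rewrite JC memvf.
  rewrite xab memv_add // memv_cap bC /=.
  by rewrite -[b](addKr a) -xab addrC memvB // (subvP sJI).
have dC' : (\dim C' < \dim I)%N.
  by rewrite -JC' dimv_disjoint_sum // -[ltnLHS]add0n ltn_add2r lt0n dimv_eq0.
have [s [ss sJ]] := IH J (leq_trans dJ dI) lJ.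
have [s' [ss' sC']] := IH C' (leq_trans dC' dI) lC'.
exists (s ++ s'); split; last by rewrite big_cat /= sJ sC'.
by move=> K; rewrite mem_cat => /orP [/ss|/ss'].
Qed.

(** Maschke's argument: averaging a linear projection onto a left ideal over a
    separability element [t] makes it a module map, whose kernel is a
    complement. *)
Lemma separable_semisimple (t : tensor A A) :
  algebra_axioms A ->
  \sw_(u, v <- t) (u ** v) = 1_A ->
  (forall a : A, \sw_(u, v <- t) tens (a ** u) v =
                 \sw_(u, v <- t) tens u (v ** a)) ->
  semisimple A.
Proof.
move=> [mA m1 _] t1 ta; apply: complemented_semisimple => I lI.
pose P : 'End(A) := linfun (fun x : A => \sw_(u, v <- t) (u ** projv I (v ** x))).
have PE x : P x = \sw_(u, v <- t) (u ** projv I (v ** x)) by apply: linfunE; lin.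
pose F x (u v : A) := u ** projv I (v ** x).
have tF x (a : A) : tlift (fun u v => F x (a ** u) v) t = tlift (fun u v => F x u (v ** a)) t.
  have := congr1 (tlift (F x)) (ta a); rewrite !tlift_comp => E.
  rewrite -[LHS](_ : \sw_(u, v <- t) tlift (F x) (tens (a ** u) v) = _).
    rewrite E; apply: eq_tlift => u v; rewrite tliftE //; rewrite /F; lin.
  apply: eq_tlift => u v; rewrite tliftE //; rewrite /F; lin.
have PM a x : P (a ** x) = a ** P x.
  rewrite !PE; transitivity (tlift (fun u v => F x u (v ** a)) t).
    by apply: eq_tlift => u v; rewrite /F mA.
  have aE (y : A) : linfun (fun z : A => a ** z) y = a ** y by apply: linfunE; lin.
  rewrite -tF -[RHS]aE tlift_comp.
  by apply: eq_tlift => u v; rewrite aE /F mA.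
have PI x : P x \in I.
  rewrite PE tlift_sum memv_suml // => i _; rewrite memv_suml // => j _.
  by rewrite memvZ // lI // memv_proj.
have Pid x : x \in I -> P x = x.
  move=> xI; rewrite PE -[RHS]m1 -t1.
  have xE (y : A) : linfun (fun z : A => z ** x) y = y ** x by apply: linfunE; lin.
  rewrite -[RHS]xE tlift_comp; apply: eq_tlift => u v.
  by rewrite xE projv_id ?lI // mA.
exists (lker P); split.
- by move=> a x; rewrite !memv_ker PM => /eqP ->; rewrite /hprod tens0r linear0.
- apply/vspaceP => x; rewrite memvf -[x](subrK (P x)) addrC.
  by rewrite memv_add ?PI // memv_ker linearB /= (Pid (P x)) ?PI // subrr.
apply/eqP; rewrite -subv0; apply/subvP => x; rewrite memv_cap memv_ker memv0.
by case/andP => /Pid ->.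
Qed.

End Semisimple.

(** * Subcoalgebras and central Hopf subalgebras *)

Section Subcoalgebras.
Variables (k : fieldType) (A : hopfData k).

(** A subspace is a subcoalgebra when it is stable under the two actions of the
    dual algebra; this lemma and the next one are how this property of a
    subcoalgebra gets used. *)
Lemma subcoalgebra_lhit (K : {vspace A}) (f : 'Hom(A, k^o)) x :
  subcoalgebra K -> x \in K -> \sw_(u, v <- comul A x) (f u : k) *: v \in K.
Proof.
move=> cK /cK; apply: tensv_image => u v _ vK.
by rewrite tliftE; [rewrite memvZ|lin|lin].
Qed.

Lemma subcoalgebra_rhit (K : {vspace A}) (f : 'Hom(A, k^o)) x :
  subcoalgebra K -> x \in K -> \sw_(u, v <- comul A x) (f v : k) *: u \in K.
Proof.
move=> cK /cK; apply: tensv_image => u v uK _.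
by rewrite tliftE; [rewrite memvZ|lin|lin].
Qed.

Lemma subcoalgebra_full : subcoalgebra (fullv : {vspace A}).
Proof. by move=> x _; exact: tensv_full. Qed.

Lemma subcoalgebra_span (s : seq A) :
  (forall x, x \in s -> comul A x \in tensv <<s>>%VS <<s>>%VS) ->
  subcoalgebra <<s>>%VS.
Proof. by move=> sC x; exact: span_image. Qed.

(** For central [x] the adjoint action collapses to
    x a_(1) S(a_(2)) = eps(a) x. *)
Lemma central_normal (L K : {vspace A}) :
  hopf_axioms A -> (forall a x : A, x \in K -> a ** x = x ** a) -> normal_in L K.
Proof.
move=> [[mA _ m1] _ _ _ [SA SA']] cK a x _ xK; split.
  rewrite -[X in X \in _](_ : x ** (counit A a *: 1_A) = _).
    by rewrite prodZr m1 memvZ.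
  have xE (y : A) : linfun (fun z : A => x ** z) y = x ** y by apply: linfunE; lin.
  rewrite -SA' -xE tlift_comp; apply: eq_tlift => u v.
  by rewrite xE mA (cK _ x).
rewrite -[X in X \in _](_ : x ** (counit A a *: 1_A) = _).
  by rewrite prodZr m1 memvZ.
have xE (y : A) : linfun (fun z : A => x ** z) y = x ** y by apply: linfunE; lin.
rewrite -SA -xE tlift_comp; apply: eq_tlift => u v.
by rewrite xE mA (cK _ x).
Qed.

End Subcoalgebras.

(** * Cosmash products *)

Record autom_action (gT : finGroupType) (I : finZmodType)
    (T : I -> gT -> gT) : Prop := AutomAction {
  autom0 : forall b, T 0 b = b;
  automD : forall i j b, T (i + j) b = T i (T j b);
  automM : forall i b c, T i (b * c)%g = (T i b * T i c)%g }.

Lemma autom1 (gT : finGroupType) (I : finZmodType) (T : I -> gT -> gT) :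
  autom_action T -> forall i, T i 1%g = 1%g.
Proof.
by move=> [_ _ TM] i; apply: (mulgI (T i 1%g)); rewrite -TM !mulg1.
Qed.

Lemma automV (gT : finGroupType) (I : finZmodType) (T : I -> gT -> gT) :
  autom_action T -> forall i b, T i b^-1%g = (T i b)^-1%g.
Proof.
move=> actT i b; apply/eqP.
by rewrite eq_sym eq_invg_mul -(automM actT) mulgV (autom1 actT).
Qed.

(** [A] has the structure constants of the smash coproduct of k[gT] with the
    algebra k^I of functions on [I]: [e b i] is b (x) delta_i, and [ec] is the
    dual basis. All properties of the biproduct are proved from these
    formulas. *)
Record cosmash_basis (k : fieldType) (A : hopfData k) (gT : finGroupType)
    (I : finZmodType) (T : I -> gT -> gT)
    (e : gT -> I -> A) (ec : gT -> I -> 'Hom(A, k^o)) : Prop := CosmashBasis {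
  cosmash_gen : forall x, x = \sum_b \sum_i ec b i x *: e b i;
  cosmash_dual : forall b i c j, ec b i (e c j) = ((c == b) && (j == i))%:R;
  cosmash_mul : forall b i c j, e b i ** e c j = (i == j)%:R *: e (b * c)%g j;
  cosmash_one : 1_A = \sum_i e 1%g i;
  cosmash_comul : forall b i,
    comul A (e b i) = \sum_a tens (e b a) (e (T a b) (i - a));
  cosmash_counit : forall b i, counit A (e b i) = (i == 0)%:R;
  cosmash_antipode : forall b i, antipode A (e b i) = e (T i b)^-1%g (- i) }.

Section CosmashHopf.
Variables (k : fieldType) (A : hopfData k) (gT : finGroupType).
Variables (I : finZmodType) (T : I -> gT -> gT).
Variables (e : gT -> I -> A) (ec : gT -> I -> 'Hom(A, k^o)).
Hypothesis Ae : cosmash_basis T e ec.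
Hypothesis actT : autom_action T.

Let T0 := autom0 actT.
Let TD := automD actT.
Let TM := automM actT.
Let mulE := cosmash_mul Ae.
Let comE := cosmash_comul Ae.

Lemma cosmash_spanning : spanning (fun q : gT * I => e q.1 q.2).
Proof.
move=> x; exists (fun q => ec q.1 q.2 x).
by rewrite [LHS](cosmash_gen Ae) pair_big.
Qed.

Lemma cosmash_ext (V : vectType k) (f g : A -> V) :
  linear f -> linear g -> (forall b i, f (e b i) = g (e b i)) ->
  forall x, f x = g x.
Proof. by move=> lf lg fg; apply: (spanning_ext cosmash_spanning lf lg) => q. Qed.

Lemma cosmash_algebra : algebra_axioms A.
Proof.
split.
- move=> x y z; move: x; apply: cosmash_ext; [lin|lin|move=> b i].
  move: y; apply: cosmash_ext; [lin|lin|move=> c j].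
  move: z; apply: cosmash_ext; [lin|lin|move=> d l].
  rewrite !mulE prodZl prodZr !mulE mulgA !scalerA; congr (_ *: _).
  by have [->|_] := eqVneq j l; rewrite ?mul0r ?mulr0 // mul1r mulr1.
- apply: cosmash_ext; [lin|lin|move=> b i].
  rewrite (cosmash_one Ae) prod_suml.
  under eq_bigr do rewrite mulE mul1g.
  by rewrite -scaler_suml (bigD1 i) //= eqxx big1 ?addr0 ?scale1r // => j /negPf ->.
apply: cosmash_ext; [lin|lin|move=> b i].
rewrite (cosmash_one Ae) prod_sumr.
under eq_bigr do rewrite mulE mulg1 eq_sym.
by rewrite sum_delta.
Qed.

Lemma cosmash_coalgebra : coalgebra_axioms A.
Proof.
split.
- apply: cosmash_ext; [lin|lin|move=> b i].
  rewrite comE sw_sum; [|lin|lin].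
  rewrite sw_sum; [|lin|lin].
  under eq_bigr => a _ do (rewrite comE sw_sum; [|lin|lin]).
  under [RHS]eq_bigr => a _ do rewrite comE tens_sumr.
  rewrite exchange_big /=; apply: eq_bigr => a _.
  rewrite (reindex_inj (addrI a)) /=; apply: eq_bigr => c _.
  by rewrite -TD addrAC subrr add0r opprD addrA [c + a]addrC.
- apply: cosmash_ext; [lin|lin|move=> b i].
  rewrite comE sw_sum; [|lin|lin].
  under eq_bigr do rewrite (cosmash_counit Ae).
  by rewrite sum_delta T0 subr0.
apply: cosmash_ext; [lin|lin|move=> b i].
rewrite comE sw_sum; [|lin|lin].
under eq_bigr do rewrite (cosmash_counit Ae) subr_eq0 eq_sym.
by rewrite sum_delta.
Qed.

Lemma cosmash_comul_mul (x y : A) : comul A (x ** y) =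
  \sw_(x1, x2 <- comul A x) \sw_(y1, y2 <- comul A y) tens (x1 ** y1) (x2 ** y2).
Proof.
move: x; apply: cosmash_ext; [lin|lin|move=> b i].
move: y; apply: cosmash_ext; [lin|lin|move=> c j].
rewrite !comE sw_sum; [|lin|lin].
under eq_bigr => a _ do (rewrite sw_sum; [|lin|lin]).
rewrite mulE linearZ /= comE scaler_sumr; apply: eq_bigr => a _.
rewrite -[RHS](_ : \sum_d (d == a)%:R *: ((i == j)%:R *:
   tens (e (b * c) d)%g (e (T a b * T d c)%g (j - d))) = _).
  by rewrite sum_delta TM.
apply: eq_bigr => d _; rewrite !mulE tensZl tensZr.
have [->|_] := eqVneq a d; last by rewrite !scale0r.
by rewrite (inj_eq (addIr _)) !scale1r.
Qed.

(** The formulas say that the coproduct is dual to the smash product of k^gT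
    with k[I]. Coassociativity is [automD], multiplicativity of the coproduct is
    [automM], and at e(b, i) every product in the antipode axioms is some
    e(1, a) if i = 0 and vanishes otherwise. *)
Lemma cosmash_hopf : hopf_axioms A.
Proof.
split.
- exact: cosmash_algebra.
- exact: cosmash_coalgebra.
- split; first exact: cosmash_comul_mul.
  rewrite (cosmash_one Ae) linear_sum /= tens_suml.
  under eq_bigr => i _ do rewrite comE.
  rewrite exchange_big; apply: eq_bigr => a _ /=.
  rewrite tens_sumr [RHS](reindex_inj (addIr (- a))) /=.
  by apply: eq_bigr => i _; rewrite (autom1 actT).
- split.
    move=> x y; move: x.
    apply: (@cosmash_ext k^o); [lin|lin|move=> b i].
    move: y; apply: (@cosmash_ext k^o); [lin|lin|move=> c j].
    rewrite mulE linearZ /= !(cosmash_counit Ae).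
    have [->|nij] := eqVneq i j; last first.
      rewrite scale0r; case: (eqVneq i 0) nij => [->|_ _]; last by rewrite mul0r.
      by rewrite eq_sym => /negPf ->; rewrite mulr0.
    by rewrite scale1r; case: eqVneq => _; rewrite ?mul1r ?mul0r.
  rewrite (cosmash_one Ae) linear_sum /= (bigD1 0) //= (cosmash_counit Ae) eqxx.
  by rewrite big1 ?addr0 // => i /negPf; rewrite (cosmash_counit Ae) => ->.
split; apply: cosmash_ext; try (by lin).
- move=> b i; rewrite comE sw_sum; [|lin|lin].
  under eq_bigr => a _ do
    rewrite (cosmash_antipode Ae) mulE mulVg eq_sym subr_eq addNr.
  rewrite -scaler_sumr (cosmash_counit Ae); have [->|_] := eqVneq i 0; last first.
    by rewrite !scale0r.
  rewrite (cosmash_one Ae) (reindex_inj (@oppr_inj I)) /=.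
  by congr (_ *: _); apply: eq_bigr => a _; rewrite opprK add0r.
move=> b i; rewrite comE sw_sum; [|lin|lin].
under eq_bigr => a _ do
  rewrite (cosmash_antipode Ae) mulE -TD subrK opprB eq_sym subr_eq.
rewrite (cosmash_counit Ae); have [->|i0] := eqVneq i 0; last first.
  rewrite scale0r big1 // => a _.
  by rewrite -[X in X == _]addr0 (inj_eq (addrI a)) eq_sym (negPf i0) scale0r.
rewrite (cosmash_one Ae) scale1r; apply: eq_bigr => a _.
by rewrite addr0 eqxx scale1r T0 mulgV subr0.
Qed.

End CosmashHopf.

(** * Group algebras *)

Section GroupAlgebra.
Variables (k : fieldType) (gT : finGroupType).
Local Notation B := (group_alg k gT).
Local Notation ge := (gelt k).

Lemma gelt_sum (a : B) : a = \sum_g (a : {ffun gT -> k^o}) g *: (ge g : B).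
Proof.
(* The operations on [B] are unfolded to the pointwise ones by restating the
   goal at the type of finite functions. *)
suff: forall a : {ffun gT -> k^o}, a = \sum_g a g *: ge g by apply.
move=> {}a; apply/ffunP => x; rewrite sum_ffunE (bigD1 x) //= big1 ?addr0.
  by rewrite !ffunE eqxx [RHS]mulr1.
by move=> g /negPf gx; rewrite !ffunE eq_sym gx [LHS]mulr0.
Qed.

Lemma gelt_spanning : spanning (fun g => ge g : B).
Proof. by move=> a; exists a; exact: gelt_sum. Qed.

Lemma gelt_ext (V : vectType k) (f h : B -> V) :
  linear f -> linear h -> (forall g, f (ge g) = h (ge g)) -> forall x, f x = h x.
Proof. exact: spanning_ext gelt_spanning. Qed.

Lemma gelt_mul (g h : gT) : (ge g : B) ** ge h = ge (g * h)%g.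
Proof.
rewrite -[LHS]/(tlift _ _) tliftE => [|v c x y|u c x y]; apply/ffunP => t.
- rewrite !ffunE (bigD1 g) //= big1 ?addr0 ?ffunE ?eqxx ?mul1r.
    by rewrite -(inj_eq (mulgI g)) mulKVg.
  by move=> y /negPf yg; rewrite ffunE yg mul0r.
- rewrite !ffunE scaler_sumr -big_split; apply: eq_bigr => s _ /=.
  by rewrite !ffunE mulrDl -mulrA.
rewrite !ffunE scaler_sumr -big_split; apply: eq_bigr => s _ /=.
by rewrite !ffunE mulrDr mulrCA.
Qed.

Lemma gelt_comul (g : gT) : comul B (ge g) = tens (ge g) (ge g).
Proof.
rewrite linfunE; last by lin.
rewrite (bigD1 g) //= big1 ?addr0 ?ffunE ?eqxx ?scale1r //.
by move=> h /negPf hg; rewrite ffunE hg scale0r.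
Qed.

Lemma gelt_counit (g : gT) : counit B (ge g) = 1.
Proof.
rewrite linfunE; last by lin.
rewrite (bigD1 g) //= big1 ?addr0 ?ffunE ?eqxx //.
by move=> h /negPf hg; rewrite ffunE hg.
Qed.

Lemma gelt_antipode (g : gT) : antipode B (ge g) = ge g^-1%g.
Proof.
rewrite linfunE => [|c x y]; apply/ffunP => h; rewrite !ffunE //.
by rewrite -(inj_eq invg_inj) invgK.
Qed.

(** A group algebra is the case of the trivial index group, so that its Hopf
    axioms are an instance of [cosmash_hopf]. *)
Lemma group_alg_cosmash_basis :
  @cosmash_basis k B gT 'I_1 (fun _ g => g) (fun g _ => ge g)
   (fun g _ => linfun (fun a : B => (a : {ffun gT -> k^o}) g)).
Proof.
have cE g (a : B) : linfun (fun a : B => (a : {ffun gT -> k^o}) g) a =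
    (a : {ffun gT -> k^o}) g by apply: linfunE; lin.
split.
- move=> a; rewrite [LHS]gelt_sum; apply: eq_bigr => g _.
  by rewrite big_ord1 cE.
- by move=> b i c j; rewrite cE ffunE !ord1 eq_sym andbT.
- by move=> b i c j; rewrite gelt_mul !ord1 scale1r.
- by rewrite big_ord1.
- by move=> b i; rewrite big_ord1 gelt_comul.
- by move=> b i; rewrite gelt_counit ord1.
by move=> b i; rewrite gelt_antipode.
Qed.

Lemma group_alg_hopf : hopf_axioms B.
Proof. by apply: (cosmash_hopf group_alg_cosmash_basis); split. Qed.

Lemma group_alg_cocommutative : cocommutative B.
Proof.
apply: gelt_ext; [lin|lin|move=> g].
by rewrite gelt_comul tliftE //; lin.
Qed.

Lemma gelt_inj : injective (@gelt k gT).
Proof.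
move=> g h /ffunP /(_ g); rewrite !ffunE eqxx.
by case: (eqVneq g h) => // _ /eqP; rewrite (oner_eq0 k).
Qed.

Lemma group_alg_abelian : commutative_hopf B -> abelian [set: gT].
Proof.
move=> cB; apply/centsP => g _ h _; apply: gelt_inj.
by rewrite -!gelt_mul cB.
Qed.

End GroupAlgebra.

(** * The support of a normal Hopf subalgebra *)

Section CosmashSupport.
Variables (k : fieldType) (A : hopfData k) (gT : finGroupType).
Variables (I : finZmodType) (T : I -> gT -> gT).
Variables (e : gT -> I -> A) (ec : gT -> I -> 'Hom(A, k^o)).
Hypothesis Ae : cosmash_basis T e ec.
Hypothesis actT : autom_action T.
Hypothesis Tsemireg : forall (i : I) b, i != 0 -> T i b = b -> forall j, T j b = b.

Let T0 := autom0 actT.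
Let TD := automD actT.
Let mulE := cosmash_mul Ae.
Let comE := cosmash_comul Ae.
Let dualE := cosmash_dual Ae.

Lemma cosmash_eq (x y : A) : (forall b i, ec b i x = ec b i y) -> x = y.
Proof.
move=> xy; rewrite [x](cosmash_gen Ae) [y](cosmash_gen Ae).
by apply: eq_bigr => b _; apply: eq_bigr => i _; rewrite xy.
Qed.

Lemma ec_row b i c (F : I -> k) :
  ec b i (\sum_j F j *: e c j) = if c == b then F i else 0.
Proof.
rewrite linear_sum (bigD1 i) //= big1 ?addr0 => [|j ji];
  rewrite linearZ /= dualE ?eqxx ?andbT; last by rewrite (negPf ji) andbF [LHS]mulr0.
by case: ifP => _; [exact: mulr1|exact: mulr0].
Qed.

(** The actions of the dual basis vector [ec b j], seen as an element of the
    dual algebra, on [A] from either side. *)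
Definition lhit b j (x : A) := \sw_(u, v <- comul A x) (ec b j u : k) *: v.
Definition rhit b j (x : A) := \sw_(u, v <- comul A x) (ec b j v : k) *: u.

Lemma lin_lhit b j : linear (lhit b j). Proof. by rewrite /lhit; lin. Qed.
Lemma lin_rhit b j : linear (rhit b j). Proof. by rewrite /rhit; lin. Qed.

Lemma lhit_e b j c i : lhit b j (e c i) = (c == b)%:R *: e (T j c) (i - j).
Proof.
rewrite /lhit comE sw_sum; [|lin|lin].
rewrite (bigD1 j) //= dualE eqxx andbT big1 ?addr0 // => a /negPf aj.
by rewrite dualE aj andbF scale0r.
Qed.

Lemma rhit_e d l c i :
  rhit d l (e c i) = (T (i - l) c == d)%:R *: e c (i - l).
Proof.
rewrite /rhit comE sw_sum; [|lin|lin].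
rewrite (bigD1 (i - l)) //= dualE subKr eqxx andbT big1 ?addr0 // => a.
rewrite dualE => al; suff /negPf -> : i - a != l by rewrite andbF scale0r.
by apply: contra al => /eqP <-; rewrite subKr.
Qed.

Lemma lhitE b j (x : A) : lhit b j x = \sum_i ec b (i + j) x *: e (T j b) i.
Proof.
rewrite {1}[x](cosmash_gen Ae) (linear_sumE _ _ (lin_lhit b j)) (bigD1 b) //=.
rewrite [X in _ + X]big1 ?addr0 => [|c /negPf cb]; last first.
  rewrite (linear_sumE _ _ (lin_lhit b j)) big1 // => i _.
  by rewrite (linear_scaleE _ _ (lin_lhit b j)) lhit_e cb scale0r scaler0.
rewrite (linear_sumE _ _ (lin_lhit b j)) (reindex_inj (addIr j)) /=.
apply: eq_bigr => i _; rewrite (linear_scaleE _ _ (lin_lhit b j)) lhit_e.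
by rewrite eqxx scale1r addrK.
Qed.

(** When the orbit of [b] is regular, the e(T_j b, l) span a matrix coalgebra:
    e(T_j b, l) is the matrix unit with row T_j b and column T_(j+l) b, and a
    left and a right action of the dual move any nonzero entry of [x] to any
    other position. *)
Lemma cosmash_orbit_sub (K : {vspace A}) (x : A) b i j l :
  (forall m, T m b = b -> m = 0) -> subcoalgebra K -> x \in K ->
  ec b i x != 0 -> e (T j b) l \in K.
Proof.
move=> bfree cK xK xbi.
have := subcoalgebra_lhit (ec b j) cK xK; rewrite -/(lhit b j x) => yK.
(* The right action below sends e(T_j b, i - j) to e(T_j b, i - j - l'), so
   that [l'] is chosen to make the second index equal to [l]. *)
pose l' := i - j - l.
have := subcoalgebra_rhit (ec (T (i - l') b) l') cK yK.
rewrite -/(rhit _ _ _) lhitE (linear_sumE _ _ (lin_rhit _ _)) (bigD1 (i - j)) //=.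
rewrite (linear_scaleE _ _ (lin_rhit _ _)) rhit_e -TD subrK addrAC subrK.
rewrite eqxx scale1r -/l' [i - j - l'](_ : _ = l); last by rewrite /l' subKr.
rewrite big1 ?addr0 => [|m mij]; first by rewrite rpredZeq (negPf xbi).
rewrite (linear_scaleE _ _ (lin_rhit _ _)) rhit_e -TD.
case: eqP => [Tm|]; last by rewrite scale0r scaler0.
clearbody l'; case/eqP: mij; apply/eqP; rewrite -subr_eq0; apply/eqP.
move/(congr1 (T (- (i - l')))): Tm; rewrite -!TD addNr T0 => /bfree <-.
by rewrite !opprB [RHS]addrC -!addrA; congr (m + _); rewrite addrCA addKr.
Qed.

(** The orbit of [b] is either regular, and [cosmash_orbit_sub] applies, or a
    single point, and then the left action of the dual translates the second
    index. *)
Lemma cosmash_shift (K : {vspace A}) (x : A) b i l :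
  subcoalgebra K -> x \in K -> ec b i x != 0 ->
  exists2 y, y \in K & ec b l y != 0.
Proof.
move=> cK xK xbi; case: (boolP [exists j, (j != 0) && (T j b == b)]).
  case/existsP=> j /andP [j0 /eqP /(Tsemireg j0) bfix].
  (* Over a fixed point the coordinate at [l] of the translate by i - l is the
     coordinate of [x] at [i]. *)
  exists (lhit b (i - l) x); first exact: subcoalgebra_lhit.
  by rewrite lhitE ec_row bfix eqxx addrC subrK.
rewrite negb_exists => /forallP bfree.
exists (e b l); last by rewrite dualE !eqxx oner_neq0.
rewrite -[b]T0; apply: cosmash_orbit_sub cK xK xbi => j Tj.
by apply/eqP; have := bfree j; rewrite Tj eqxx andbT negbK.
Qed.

(** The left action of [ec b 0] is the projection to the row of [b], as [T 0]
    is the identity: subcoalgebras are graded by [gT]. *)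
Lemma cosmash_project (K : {vspace A}) (x : A) b :
  subcoalgebra K -> x \in K -> \sum_i ec b i x *: e b i \in K.
Proof.
move=> cK /(subcoalgebra_lhit (ec b 0%R) cK).
rewrite -/(lhit b 0 x) lhitE T0.
by under eq_bigr do rewrite addr0.
Qed.

Lemma cosmash_row_mul b c (F G : I -> k) :
  (\sum_i F i *: e b i) ** (\sum_i G i *: e c i) =
  \sum_i (F i * G i) *: e (b * c)%g i.
Proof.
rewrite prod_suml; apply: eq_bigr => i _; rewrite prod_sumr.
rewrite (bigD1 i) //= big1 ?addr0 => [|j]; rewrite prodZl prodZr mulE.
  by rewrite eqxx scale1r scalerA.
by rewrite eq_sym => /negPf ->; rewrite scale0r !scaler0.
Qed.

Lemma e_row b i : e b i = \sum_j (j == i)%:R *: e b j.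
Proof. by rewrite sum_delta. Qed.

(** In the coproduct of e(b, 0) the a-th term pairs e(b, a) with an antipode
    equal to e(b^-1, a); so the a-th term picks the a-th entry of the row and
    conjugates its group label. *)
Lemma cosmash_adjoint b c (F : I -> k) :
  \sw_(u, v <- comul A (e b 0))
     (u ** (\sum_i F i *: e c i) ** antipode A v) =
  \sum_i F i *: e (b * c * b^-1)%g i.
Proof.
rewrite comE sw_sum; [|lin|lin]; apply: eq_bigr => a _.
rewrite (cosmash_antipode Ae) sub0r opprK -TD addNr T0.
rewrite (e_row b a) (e_row b^-1 a) !cosmash_row_mul.
rewrite (bigD1 a) //= eqxx mul1r mulr1 big1 ?addr0 // => i /negPf ia.
by rewrite ia mulr0 scale0r.
Qed.

(** For a subcoalgebra [K], these group elements span the image of [K] in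
    k[gT]. Testing the coordinate at 0 is enough, by [cosmash_shift]. *)
Definition cosmash_support (K : {vspace A}) : {set gT} :=
  [set b | ~~ (K <= lker (ec b 0%R))%VS].

Lemma cosmash_supportP (K : {vspace A}) b :
  reflect (exists2 x, x \in K & ec b 0 x != 0) (b \in cosmash_support K).
Proof.
rewrite inE; apply: (iffP (@subvPn _ _ K (lker (ec b 0%R)))) => [] [x xK xb];
  exists x => //; by move: xb; rewrite memv_ker.
Qed.

(** Rows multiply entrywise, so nonzero entries at the index 0 multiply to a
    nonzero entry at 0. *)
Lemma cosmash_support_group (K : {vspace A}) :
  hopf_subalg K -> group_set (cosmash_support K).
Proof.
move=> [K1 KM cK _]; apply/group_setP; split.
  apply/cosmash_supportP; exists 1_A => //.
  rewrite (cosmash_one Ae) linear_sum (bigD1 0) //= dualE !eqxx big1 ?addr0 ?oner_neq0 //.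
  by move=> i /negPf i0; rewrite dualE i0 andbF.
move=> b c /cosmash_supportP [x xK xb] /cosmash_supportP [y yK yc].
apply/cosmash_supportP.
exists ((\sum_i ec b i x *: e b i) ** (\sum_i ec c i y *: e c i)).
  by rewrite KM ?cosmash_project.
by rewrite cosmash_row_mul ec_row eqxx mulf_neq0.
Qed.

Lemma cosmash_support_norm (K : {vspace A}) b c :
  normal_hopf_subalg K -> c \in cosmash_support K ->
  (b * c * b^-1)%g \in cosmash_support K.
Proof.
move=> [[_ _ cK _] nK] /cosmash_supportP [x xK xc].
have [+ _] := nK (e b 0) _ (memvf _) (cosmash_project c cK xK).
rewrite cosmash_adjoint => yK; apply/cosmash_supportP; eexists; first exact: yK.
by rewrite ec_row eqxx.
Qed.

Lemma cosmash_support_normal (K : {vspace A}) :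
  simple [set: gT] -> normal_hopf_subalg K ->
  cosmash_support K = 1%g \/ cosmash_support K = setT.
Proof.
move=> /simpleP [_ simG] nK.
have gN := cosmash_support_group nK.1.
apply: (simG (group gN)); rewrite /normal subsetT; apply/subsetP => b _.
rewrite inE; apply/subsetP => _ /imsetP [c cN ->].
by rewrite conjgE -{2}[b]invgK mulgA cosmash_support_norm.
Qed.

(** A point [b0] moved by the action has a regular orbit, as has its inverse,
    so [K] contains e(1, l) = e(b0, l) e(b0^-1, l) for all [l]. Multiplying by
    e(1, l) isolates the l-th entry of a row, and [cosmash_shift] provides, over
    every [b], a row in which that entry is nonzero. *)
Lemma cosmash_support_full (K : {vspace A}) i0 b0 :
  T i0 b0 != b0 -> hopf_subalg K -> cosmash_support K = setT -> K = fullv.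
Proof.
move=> Tb0 [_ KM cK _] NT.
have inN b : exists2 x, x \in K & ec b 0 x != 0.
  by apply/cosmash_supportP; rewrite NT inE.
have freeb b : T i0 b != b -> forall l, e b l \in K.
  move=> Tb l; have [x xK xb] := inN b; rewrite -[b]T0.
  apply: cosmash_orbit_sub cK xK xb => j Tj.
  by apply/eqP; apply: contraR Tb => j0; rewrite (Tsemireg j0 Tj).
have e1K l : e 1%g l \in K.
  rewrite -(mulgV b0); have := mulE b0 l b0^-1%g l; rewrite eqxx scale1r => <-.
  by rewrite KM // freeb // (automV actT) (inj_eq invg_inj).
apply/vspaceP => x; rewrite memvf [x](cosmash_gen Ae).
rewrite memv_suml // => b _; rewrite memv_suml // => l _; apply: memvZ.
have [y yK yb] := inN b; have [z zK zb] := cosmash_shift l cK yK yb.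
have := KM _ _ (e1K l) (cosmash_project b cK zK).
rewrite (e_row 1%g l) cosmash_row_mul (bigD1 l) //= big1 ?addr0 => [|j /negPf ->].
  by rewrite eqxx !mul1r rpredZeq (negPf zb) mul1g.
by rewrite mul0r scale0r.
Qed.

(** The separability idempotent is 1/|gT| times the sum of the
    e(b^-1, i) (x) e(b, i), one copy of the one of k[gT] for each [i]. *)
Lemma cosmash_separable : #|[set: gT]|%:R != 0 :> k -> semisimple A.
Proof.
move=> G0; apply: (@separable_semisimple _ _
  (#|[set: gT]|%:R^-1 *: \sum_(q : gT * I) tens (e q.1^-1%g q.2) (e q.1 q.2))).
- exact: cosmash_algebra Ae.
- rewrite linearZ /= sw_sum; [|lin|lin].
  under eq_bigr do rewrite mulE eqxx scale1r mulVg.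
  rewrite -(pair_big xpredT xpredT (fun _ i => e 1%g i)) /= -(cosmash_one Ae).
  by rewrite sumr_const -cardsT -scaler_nat scalerA mulVf // scale1r.
move=> a; rewrite !linearZ /=; congr (_ *: _).
rewrite sw_sum; [|lin|lin]; rewrite sw_sum; [|lin|lin].
move: a; apply: (cosmash_ext Ae); [lin|lin|move=> c j].
under eq_bigr do rewrite mulE.
under [RHS]eq_bigr do rewrite mulE.
rewrite (reindex (fun q : gT * I => (q.1 * c, q.2)%g)) /=; last first.
  exists (fun q : gT * I => (q.1 * c^-1, q.2)%g) => [[b i] _|[b i] _] /=.
    by rewrite mulgK.
  by rewrite mulgKV.
apply: eq_bigr => q _; rewrite tensZl tensZr invMg mulKVg eq_sym.
by case: eqP => [->|]; rewrite ?scale0r.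
Qed.

Lemma cosmash_noncommutative : ~~ abelian [set: gT] -> ~ commutative_hopf A.
Proof.
move=> nab cA; case/negP: nab; apply/centsP => b _ c _; apply/eqP.
have := congr1 (ec (b * c)%g 0) (cA (e b 0) (e c 0)).
rewrite !mulE eqxx !scale1r !dualE !eqxx; case: eqP => [-> //|_] /eqP.
by rewrite oner_eq0.
Qed.

(** For [b0] moved by [T i0], the tensor e(b0, i0) (x) e(T_i0 b0, 0) occurs in
    the coproduct of e(b0, i0), and its flip does not. *)
Lemma cosmash_noncocommutative i0 b0 : T i0 b0 != b0 -> ~ cocommutative A.
Proof.
move=> Tb0 cA; pose b1 := T i0 b0.
pose f (u v : A) := (ec b0 i0 u : k) * ec b1 0 v : k^o.
have := congr1 (tlift f) (cA (e b0 i0)).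
rewrite tlift_comp comE sw_sum; [|lin|lin].
rewrite sw_sum; [|rewrite /f; lin|rewrite /f; lin].
rewrite [X in X = _]big1 => [|a _]; last first.
  rewrite tliftE; [|rewrite /f; lin|rewrite /f; lin].
  by rewrite /f !dualE [_ == b1]eq_sym (negPf Tb0) mulr0.
rewrite (bigD1 i0) //= /f !dualE subrr !eqxx mulr1 big1 ?addr0 => [/eqP|a /negPf ai].
  by rewrite eq_sym oner_eq0.
by rewrite !dualE ai andbF mul0r.
Qed.

End CosmashSupport.

(** * Group-like elements and cosemisimplicity *)

(** [chi] identifies [cT] with the group of characters of [I] and [psi] is the
    inverse matrix: this identifies k[cT] with the algebra of functions on
    [I]. *)
Record character_table (k : fieldType) (cT : finGroupType) (I : finZmodType)
    (chi : cT -> I -> k) (psi : I -> cT -> k) : Prop := CharacterTable {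
  chi0 : forall g, chi g 0 = 1;
  chiD : forall g i j, chi g (i + j) = chi g i * chi g j;
  chi1 : forall i, chi 1%g i = 1;
  chiM : forall g h i, chi (g * h)%g i = chi g i * chi h i;
  chi_psi : forall i j, \sum_g psi i g * chi g j = (i == j)%:R;
  psi_chi : forall g h, \sum_i psi i g * chi h i = (g == h)%:R }.

Lemma sub_sum_seq (k : fieldType) (V : vectType k) (s : seq {vspace V})
    (U : {vspace V}) : U \in s -> (U <= \sum_(W <- s) W)%VS.
Proof. by move=> Us; rewrite (big_rem U) //= addvSl. Qed.

Section CosmashGrouplikes.
Variables (k : fieldType) (A : hopfData k) (gT cT : finGroupType).
Variables (I : finZmodType) (T : I -> gT -> gT).
Variables (e : gT -> I -> A) (ec : gT -> I -> 'Hom(A, k^o)).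
Variables (chi : cT -> I -> k) (psi : I -> cT -> k).
Hypothesis Ae : cosmash_basis T e ec.
Hypothesis actT : autom_action T.
Hypothesis Tsemireg : forall (i : I) b, i != 0 -> T i b = b -> forall j, T j b = b.
Hypothesis chiP : character_table chi psi.

Let T0 := autom0 actT.
Let TD := automD actT.
Let comE := cosmash_comul Ae.
Let dualE := cosmash_dual Ae.

(** The element b x g of the biproduct. *)
Definition bgelt b (g : cT) : A := \sum_i chi g i *: e b i.

Lemma e_bgelt b i : e b i = \sum_g psi i g *: bgelt b g.
Proof.
under eq_bigr do rewrite /bgelt scaler_sumr.
rewrite exchange_big /=.
under eq_bigr => j _ do under eq_bigr do rewrite scalerA.
under eq_bigr => j _ do rewrite -scaler_suml (chi_psi chiP) eq_sym.
by rewrite sum_delta.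
Qed.

Lemma ec_bgelt b i c g : ec b i (bgelt c g) = if c == b then chi g i else 0.
Proof. exact: (ec_row Ae). Qed.

Lemma bgelt_neq0 b g : bgelt b g != 0.
Proof.
apply/eqP => /(congr1 (ec b 0)) /eqP; rewrite ec_bgelt eqxx linear0.
by rewrite (chi0 chiP) (oner_eq0 k).
Qed.

(** Over a fixed point [b] the coproduct only involves the second index, and
    characters are group-like. *)
Lemma bgelt_comul b g :
  (forall i, T i b = b) -> comul A (bgelt b g) = tens (bgelt b g) (bgelt b g).
Proof.
move=> bfix; rewrite /bgelt linear_sum /= tens_suml.
under eq_bigr => i _ do rewrite linearZ /= comE scaler_sumr.
rewrite exchange_big; apply: eq_bigr => a _ /=.
rewrite tens_sumr (reindex_inj (addrI a)) /=; apply: eq_bigr => i _.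
by rewrite bfix tensZl tensZr scalerA (chiD chiP) addrAC subrr add0r.
Qed.

Lemma bgelt_mul b c g h : bgelt b g ** bgelt c h = bgelt (b * c)%g (g * h)%g.
Proof.
rewrite (cosmash_row_mul Ae); apply: eq_bigr => i _.
by rewrite (chiM chiP).
Qed.

Lemma bgelt_one : bgelt 1%g 1%g = 1_A.
Proof.
rewrite (cosmash_one Ae); apply: eq_bigr => i _.
by rewrite (chi1 chiP) scale1r.
Qed.

Lemma bgelt_counit b g : counit A (bgelt b g) = 1.
Proof.
rewrite linear_sum (bigD1 0) //= linearZ /= (cosmash_counit Ae) eqxx (chi0 chiP).
rewrite scale1r big1 ?addr0 // => i /negPf i0.
by rewrite linearZ /= (cosmash_counit Ae) i0 scaler0.
Qed.

Let T1 := autom1 actT.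

Lemma chi_inv g i : chi g^-1%g i = chi g (- i).
Proof.
have nz : chi g i != 0.
  apply/eqP => gi; have /eqP := chi1 chiP i.
  by rewrite -(mulgV g) (chiM chiP) gi mul0r eq_sym oner_eq0.
apply: (mulIf nz); rewrite -(chiM chiP) -(chiD chiP) mulVg addNr.
by rewrite (chi0 chiP) (chi1 chiP).
Qed.

Lemma bgelt_antipode g : antipode A (bgelt 1%g g) = bgelt 1%g g^-1%g.
Proof.
rewrite /bgelt linear_sum /= [RHS](reindex_inj (@oppr_inj I)) /=.
apply: eq_bigr => i _; rewrite linearZ /= (cosmash_antipode Ae) T1 invg1.
by rewrite chi_inv opprK.
Qed.

(** A regular orbit contributes a matrix coalgebra, which is simple by
    [cosmash_orbit_sub]; a fixed point [b] contributes the lines spanned by the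
    group-like elements b x g. *)
Lemma cosmash_cosemisimple : cosemisimple A.
Proof.
pose fixb b := [forall i, T i b == b].
pose orb b := <<[seq e (T q.1 b) q.2 | q <- enum [set: I * I]]>>%VS.
exists ([seq orb b | b <- enum gT & ~~ fixb b] ++
        [seq <[bgelt q.1 q.2]>%VS | q <- enum [set: gT * cT] & fixb q.1]).
split; last first.
  apply/vspaceP => x; rewrite memvf [x](cosmash_gen Ae).
  rewrite memv_suml // => b _; rewrite memv_suml // => i _; apply: memvZ.
  case: (boolP (fixb b)) => [bfix|bfree].
    rewrite e_bgelt memv_suml // => g _; apply: memvZ.
    apply: (subvP (sub_sum_seq _) _ (memv_line _)); rewrite mem_cat.
    apply/orP; right; apply/mapP; exists (b, g) => //.
    by rewrite mem_filter bfix mem_enum inE.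
  have bi : e b i \in orb b.
    by apply: memv_span; apply/mapP; exists (0, i); rewrite ?mem_enum ?inE //= T0.
  apply: (subvP (sub_sum_seq _) _ bi); rewrite mem_cat.
  by apply/orP; left; apply/mapP; exists b; rewrite // mem_filter bfree mem_enum.
move=> C; rewrite mem_cat => /orP [] /mapP [].
  move=> b; rewrite mem_filter => /andP [bfree _] ->.
  have memo i l : e (T i b) l \in orb b.
    by apply: memv_span; apply/mapP; exists (i, l); rewrite ?mem_enum ?inE.
  have bf m : T m b = b -> m = 0.
    move=> Tm; apply/eqP; apply: contraR bfree => m0; apply/forallP => j.
    by apply/eqP; exact: Tsemireg Tm _.
  split.
  - apply: subcoalgebra_span => _ /mapP [[i l] _ ->] /=.
    by rewrite comE memv_suml // => a _; rewrite -TD tens_mem ?memo.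
  - by move=> b0; have := memo 0 0; rewrite b0 memv0 => /eqP /(congr1 (ec (T 0 b) 0)) /eqP;
      rewrite dualE !eqxx linear0 (oner_eq0 k).
  move=> D cD Db; have [->|D0] := eqVneq D 0%VS; [by left|right].
  apply/eqP; rewrite eqEsubv Db /=.
  have xD := memv_pick D; have x0 : vpick D != 0 by rewrite vpick0.
  have [c [i xci]] : exists c i, ec c i (vpick D) != 0.
    case: (boolP [exists q : gT * I, ec q.1 q.2 (vpick D) != 0]) => [/existsP [[c i] ci]|].
      by exists c, i.
    rewrite negb_exists => /forallP xz; case/eqP: x0; apply: (cosmash_eq Ae) => c i.
    by rewrite linear0; apply/eqP; have := xz (c, i); rewrite negbK.
  have [j cj] : exists j, c = T j b.
    suff /existsP [j /eqP] : [exists j, c == T j b] by exists j.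
    apply: contraR xci; rewrite negb_exists => /forallP nc.
    rewrite -memv_ker; apply: (subvP _ _ (subvP Db _ xD)).
    apply/span_subvP => _ /mapP [[j l] _ ->] /=; rewrite memv_ker dualE.
    by have := nc j; rewrite eq_sym => /negPf ->.
  apply/span_subvP => _ /mapP [[i' l] _ ->] /=.
  rewrite -(subrK j i') TD -cj; apply: (cosmash_orbit_sub Ae actT _ _ _ cD xD xci).
  move=> m; rewrite cj -TD addrC => /(congr1 (T (- j))).
  by rewrite -!TD addKr addNr T0; exact: bf.
move=> [b g]; rewrite mem_filter => /andP [/forallP bfix _] -> /=.
split.
- move=> x /vlineP [a ->]; rewrite linearZ /= bgelt_comul => [|i].
    by rewrite memvZ // tens_mem ?memv_line.
  exact/eqP.
- by move/eqP; rewrite -subv0 -memvE memv0 (negPf (bgelt_neq0 b g)).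
move=> D _ Dl; have [->|D0] := eqVneq D 0%VS; [by left|right].
apply/eqP; rewrite eqEdim Dl dim_vline bgelt_neq0 lt0n dimv_eq0 //.
Qed.

End CosmashGrouplikes.

(** * Normal Hopf subalgebras and their quotients *)

Section CosmashNormal.
Variables (k : fieldType) (A : hopfData k) (gT cT : finGroupType).
Variables (I : finZmodType) (T : I -> gT -> gT).
Variables (e : gT -> I -> A) (ec : gT -> I -> 'Hom(A, k^o)).
Variables (chi : cT -> I -> k) (psi : I -> cT -> k).
Hypothesis Ae : cosmash_basis T e ec.
Hypothesis actT : autom_action T.
Hypothesis Tsemireg : forall (i : I) b, i != 0 -> T i b = b -> forall j, T j b = b.
Hypothesis chiP : character_table chi psi.

Let T0 := autom0 actT.
Let mulE := cosmash_mul Ae.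
Let comE := cosmash_comul Ae.
Let dualE := cosmash_dual Ae.
Let hopfA : hopf_axioms A := cosmash_hopf Ae actT.
Let T1 := autom1 actT.
Local Notation u := (bgelt e chi 1%g).

Definition calH : {vspace A} := <<[seq u g | g <- enum cT]>>%VS.

Lemma bgelt_calH g : u g \in calH.
Proof. by apply: memv_span; apply: map_f; rewrite mem_enum. Qed.

Lemma e1_calH i : e 1%g i \in calH.
Proof.
by rewrite (e_bgelt e chiP) memv_suml // => g _; rewrite memvZ ?bgelt_calH.
Qed.

Lemma calH_span (W : vectType k) (M : {vspace W}) (h : 'Hom(A, W)) x :
  (forall g, h (u g) \in M) -> x \in calH -> h x \in M.
Proof. by move=> hM; apply: span_image => _ /mapP [g _ ->]. Qed.

Lemma calH_mul x y : x \in calH -> y \in calH -> x ** y \in calH.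
Proof.
move=> + yH.
have rE (z : A) : linfun (fun x : A => x ** y) z = z ** y by apply: linfunE; lin.
rewrite -rE; apply: calH_span => g; rewrite rE.
have lE (z : A) : linfun (fun y : A => u g ** y) z = u g ** z by apply: linfunE; lin.
rewrite -lE; apply: calH_span yH => h; rewrite lE (bgelt_mul Ae chiP) mulg1.
exact: bgelt_calH.
Qed.

(** Left and right multiplication by e(1, i) both select the second index
    [i]. *)
Lemma calH_central a x : x \in calH -> a ** x = x ** a.
Proof.
apply: (span_ext (f := fun x => a ** x) (g := fun x => x ** a)); [lin|lin|].
move=> _ /mapP [g _ ->]; move: a; apply: (cosmash_ext Ae); [lin|lin|move=> c j].
rewrite (e_row e c j) !(cosmash_row_mul Ae) mulg1 mul1g.
by apply: eq_bigr => i _; rewrite mulrC.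
Qed.

Lemma calH_hopf_subalg : hopf_subalg calH.
Proof.
split.
- by rewrite -(bgelt_one Ae chiP) bgelt_calH.
- exact: calH_mul.
- move=> x; apply: calH_span => g.
  by rewrite (bgelt_comul Ae chiP) // tens_mem ?bgelt_calH.
move=> x; apply: calH_span => g.
by rewrite (bgelt_antipode Ae actT chiP) bgelt_calH.
Qed.

Lemma line_hopf_subalg : hopf_subalg <[1_A]>%VS.
Proof.
have uE := bgelt_one Ae chiP.
split; first exact: memv_line.
- move=> _ _ /vlineP [a ->] /vlineP [b ->]; rewrite prodZl prodZr.
  have [[_ m1 _] _ _ _ _] := hopfA.
  by rewrite m1 !memvZ ?memv_line.
- move=> _ /vlineP [a ->]; rewrite linearZ /= -uE (bgelt_comul Ae chiP) //.
  by rewrite memvZ // tens_mem ?memv_line.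
move=> _ /vlineP [a ->]; rewrite linearZ /= -uE (bgelt_antipode Ae actT chiP) invg1.
by rewrite memvZ ?memv_line.
Qed.

Lemma full_hopf_subalg : hopf_subalg (fullv : {vspace A}).
Proof.
by split=> *; rewrite ?memvf //; exact: subcoalgebra_full.
Qed.

(** The coordinates on [calH] along the group-like elements 1 x g. *)
Definition calH_coord g : 'Hom(A, k^o) := linfun (fun x => \sum_i psi i g *: ec 1%g i x).

Lemma calH_coord_bgelt g h : calH_coord g (u h) = (g == h)%:R.
Proof.
rewrite linfunE; last by lin.
under eq_bigr do rewrite (ec_bgelt chi Ae) eqxx.
exact: (psi_chi chiP).
Qed.

Lemma calH_support (x : A) :
  (forall c i, c != 1%g -> ec c i x = 0) -> x \in calH.
Proof.
move=> x1; rewrite [x](cosmash_gen Ae) memv_suml // => c _; rewrite memv_suml // => i _.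
have [->|/x1 ->] := eqVneq c 1%g; first by rewrite memvZ ?e1_calH.
by rewrite scale0r mem0v.
Qed.

Lemma calH_sum (x : A) : x \in calH -> x = \sum_g calH_coord g x *: u g.
Proof.
move: x; apply: span_ext; [lin|lin|move=> _ /mapP [g _ ->]].
under eq_bigr do rewrite calH_coord_bgelt.
by rewrite sum_delta.
Qed.

Lemma cosmash_sub_calH (K : {vspace A}) :
  hopf_subalg K -> cosmash_support ec K = 1%g -> (K <= calH)%VS.
Proof.
move=> [_ _ cK _] NT; apply/subvP => x xK; apply: calH_support => c i c1.
apply/eqP; apply: contraR c1 => xci.
have [y yK yc] := cosmash_shift Ae actT Tsemireg 0 cK xK xci.
have : c \in cosmash_support ec K by apply/cosmash_supportP; exists y.
by rewrite NT => /set1P ->.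
Qed.

(** Acting by [calH_coord g] projects onto the line of 1 x g, so [K] is spanned
    by the 1 x g it contains. These form a subgroup of a group of prime
    order. *)
Lemma hopf_subalg_calH (K : {vspace A}) : prime #|cT| ->
  hopf_subalg K -> (K <= calH)%VS -> K = <[1_A]>%VS \/ K = calH.
Proof.
move=> prc [K1 KM cK _] KH.
pose L := [set g | u g \in K].
have gL : group_set L.
  apply/group_setP; split; first by rewrite inE (bgelt_one Ae chiP).
  by move=> g h; rewrite !inE => gK hK; rewrite -(mulg1 1%g) -(bgelt_mul Ae chiP) KM.
have inL x g : x \in K -> calH_coord g x != 0 -> g \in L.
  move=> xK xg; rewrite inE; have := subcoalgebra_lhit (calH_coord g) cK xK.
  rewrite {1}(calH_sum (subvP KH _ xK)) linear_sum /=.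
  under eq_bigr do rewrite linearZ /= (bgelt_comul Ae chiP) //.
  rewrite linear_sum (bigD1 g) //= big1 ?addr0 => [|h hg]; rewrite linearZ /= tliftE; try by lin.
    by rewrite calH_coord_bgelt eqxx scale1r rpredZeq (negPf xg).
  by rewrite calH_coord_bgelt eq_sym (negPf hg) scale0r scaler0.
have : (#|group gL| %| #|cT|)%N by rewrite -cardsT cardSg ?subsetT.
rewrite /= => dL.
have [L1|/(prime_nt_dvdP prc)/(_ dL) Lp] := eqVneq #|L| 1%N; [left|right].
  have {}L1 : L = 1%g by exact: (@card1_trivg _ (group gL)).
  apply/eqP; rewrite eqEsubv -memvE K1 andbT; apply/subvP => x xK.
  rewrite (calH_sum (subvP KH _ xK)) memv_suml // => g _.
  have [->|/(inL _ _ xK)] := eqVneq (calH_coord g x) 0; first by rewrite scale0r mem0v.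
  by rewrite L1 => /set1P ->; rewrite (bgelt_one Ae chiP) memvZ ?memv_line.
apply/eqP; rewrite eqEsubv KH; apply/span_subvP => _ /mapP [g _ ->].
suff : g \in L by rewrite inE.
suff -> : L = setT by rewrite inE.
by apply/eqP; rewrite eqEcard subsetT cardsT Lp leqnn.
Qed.

Lemma cosmash_normal_subalg (K : {vspace A}) i0 b0 :
  prime #|cT| -> simple [set: gT] -> T i0 b0 != b0 ->
  normal_hopf_subalg K <-> [\/ K = <[1_A]>%VS, K = calH | K = fullv].
Proof.
move=> prc simG Tb0; split=> [nK|].
  have [N1|NT] := cosmash_support_normal Ae actT simG nK.
    by case: (hopf_subalg_calH prc nK.1 (cosmash_sub_calH nK.1 N1)) => ->;
      [apply: Or31|apply: Or32].
  by apply: Or33; apply: (cosmash_support_full Ae actT Tsemireg Tb0 nK.1 NT).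
have [[_ m1 m1'] _ _ _ _] := hopfA.
case=> ->; split.
- exact: line_hopf_subalg.
- apply: central_normal => // a _ /vlineP [c ->].
  by rewrite prodZl prodZr m1 m1'.
- exact: calH_hopf_subalg.
- by apply: central_normal => // a x; exact: calH_central.
- exact: full_hopf_subalg.
by move=> a x _ _; rewrite !memvf.
Qed.

Definition calH_embed : 'Hom(group_alg k cT, A) :=
  linfun (fun a : group_alg k cT => \sum_g (a : {ffun cT -> k^o}) g *: u g).

Lemma calH_embedE (a : group_alg k cT) :
  calH_embed a = \sum_g (a : {ffun cT -> k^o}) g *: u g.
Proof. by apply: linfunE; lin. Qed.

Lemma calH_embed_gelt g : calH_embed (gelt k g : group_alg k cT) = u g.
Proof.
by rewrite calH_embedE; under eq_bigr do rewrite ffunE; rewrite sum_delta.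
Qed.

Lemma calH_iso : hopf_iso (hopf_sub calH) (group_alg k cT).
Proof.
apply: (@inj_hopf_sub_iso _ _ _ calH_embed).
- split.
  + split=> [x y|]; last by rewrite calH_embed_gelt (bgelt_one Ae chiP).
    move: x; apply: gelt_ext; [lin|lin|move=> g].
    move: y; apply: gelt_ext; [lin|lin|move=> h].
    by rewrite gelt_mul !calH_embed_gelt (bgelt_mul Ae chiP) mulg1.
  + apply: gelt_ext; [lin|lin|move=> g].
    by rewrite calH_embed_gelt gelt_comul tmap_tens (bgelt_comul Ae chiP) // !calH_embed_gelt.
  + apply: (gelt_ext (V := k^o)); [lin|lin|move=> g].
    by rewrite calH_embed_gelt gelt_counit (bgelt_counit Ae chiP).
  apply: gelt_ext; [lin|lin|move=> g].
  by rewrite calH_embed_gelt gelt_antipode (bgelt_antipode Ae actT chiP) calH_embed_gelt.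
- apply/eqP; rewrite -subv0; apply/subvP => a; rewrite memv_ker memv0 => /eqP a0.
  apply/eqP; apply/ffunP => g; have := congr1 (calH_coord g) a0.
  rewrite calH_embedE linear_sum (bigD1 g) //= linearZ /= calH_coord_bgelt eqxx.
  rewrite linear0 big1 ?addr0 => [|h hg]; last first.
    by rewrite linearZ /= calH_coord_bgelt eq_sym (negPf hg) scaler0.
  by rewrite ffunE => <-; rewrite [RHS]mulr1.
apply/eqP; rewrite eqEsubv; apply/andP; split.
  apply/subvP => _ /memv_imgP [a _ ->]; rewrite calH_embedE memv_suml // => g _.
  by rewrite memvZ ?bgelt_calH.
apply/span_subvP => _ /mapP [g _ ->].
by rewrite -calH_embed_gelt memv_img ?memvf.
Qed.

(** The Hopf algebra map b x h |-> eps(h) b. *)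
Definition cosmash_proj : 'Hom(A, group_alg k gT) :=
  linfun (fun x : A => [ffun b => ec b 0%R x] : group_alg k gT).

Lemma cosmash_projE x : cosmash_proj x = [ffun b => ec b 0%R x].
Proof.
by apply: linfunE => a y z; apply/ffunP => b; rewrite !ffunE linearP.
Qed.

Lemma cosmash_proj_e b i : cosmash_proj (e b i) = (i == 0)%:R *: gelt k b.
Proof.
rewrite cosmash_projE; apply/ffunP => c; rewrite !ffunE dualE eq_sym.
by case: (i == 0); case: (c == b); rewrite /= ?scale1r ?scale0r ?mulr0.
Qed.

Lemma cosmash_proj_morph : hopf_morph cosmash_proj.
Proof.
split.
- split=> [x y|].
    move: x; apply: (cosmash_ext Ae); [lin|lin|move=> b i].
    move: y; apply: (cosmash_ext Ae); [lin|lin|move=> c j].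
    rewrite mulE linearZ /= !cosmash_proj_e prodZl prodZr gelt_mul !scalerA.
    congr (_ *: _); have [->|ij] := eqVneq i j.
      by rewrite mul1r; case: (j == 0); rewrite ?mulr0 ?mulr1.
    rewrite mul0r; have [i0|_] := eqVneq i 0; last by rewrite mul0r.
    by rewrite -i0 eq_sym (negPf ij) mulr0.
  rewrite (cosmash_one Ae) linear_sum /=.
  under eq_bigr do rewrite cosmash_proj_e.
  by rewrite sum_delta.
- apply: (cosmash_ext Ae); [lin|lin|move=> b i].
  rewrite cosmash_proj_e linearZ /= gelt_comul comE linear_sum /=.
  rewrite (bigD1 0) //= big1 ?addr0 => [|a /negPf a0]; rewrite tmap_tens !cosmash_proj_e.
    by rewrite eqxx scale1r T0 subr0 tensZr.
  by rewrite a0 scale0r tens0l.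
- apply: (cosmash_ext Ae (V := k^o)); [lin|lin|move=> b i].
  by rewrite cosmash_proj_e linearZ /= gelt_counit (cosmash_counit Ae) [LHS]mulr1.
apply: (cosmash_ext Ae); [lin|lin|move=> b i].
rewrite cosmash_proj_e linearZ /= gelt_antipode (cosmash_antipode Ae) cosmash_proj_e.
by rewrite oppr_eq0; have [->|] := eqVneq i 0; rewrite ?T0 // !scale0r.
Qed.

Lemma cosmash_proj_surj : limg cosmash_proj = fullv.
Proof.
apply/vspaceP => a; rewrite memvf [a]gelt_sum memv_suml // => g _.
rewrite memvZ // -[gelt k g]scale1r -(_ : cosmash_proj (e g 0) = 1 *: gelt k g).
  by rewrite memv_img ?memvf.
by rewrite cosmash_proj_e eqxx.
Qed.

Lemma cosmash_proj_calH x : x \in calH -> counit A x = 0 -> cosmash_proj x = 0.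
Proof.
move=> xH x0; rewrite -(scale0r 1_(group_alg k gT)) -x0.
move: x xH {x0}; apply: span_ext; [lin|lin|move=> _ /mapP [g _ ->]].
rewrite (bgelt_counit Ae chiP) scale1r linear_sum /=.
under eq_bigr do rewrite linearZ /= cosmash_proj_e scalerA mulrC -scalerA.
by rewrite sum_delta (chi0 chiP) scale1r.
Qed.

(** The kernel is spanned by the e(b, i) = e(1, i) e(b, i) with i nonzero, and
    then e(1, i) lies in [calH] and in the kernel of the counit. *)
Lemma lker_cosmash_proj : lker cosmash_proj = plus_ideal calH.
Proof.
have [[fM _] _ _ _] := cosmash_proj_morph.
apply/eqP; rewrite eqEsubv; apply/andP; split; last first.
  apply/span_subvP => _ /allpairsP [[x y] [/= /vbasis_mem xH _ ->]].
  move: xH; rewrite memv_cap memv_ker => /andP [xH /eqP x0].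
  by rewrite memv_ker fM cosmash_proj_calH // /hprod tens0l linear0.
apply/subvP => x; rewrite memv_ker cosmash_projE => /eqP /ffunP x0.
rewrite [x](cosmash_gen Ae) memv_suml // => b _; rewrite memv_suml // => i _.
have [->|i0] := eqVneq i 0.
  by have := x0 b; rewrite !ffunE => ->; rewrite scale0r mem0v.
have -> : e b i = e 1%g i ** e b i by rewrite mulE eqxx scale1r mul1g.
rewrite memvZ //.
have pl (y z : A) : y \in (calH :&: lker (counit A))%VS -> y ** z \in plus_ideal calH.
  move=> /vbasis_sum [c ->]; have /vbasis_sum [d ->] := memvf z.
  rewrite prod_suml memv_suml // => s _; rewrite prod_sumr memv_suml // => t _.
  rewrite prodZl prodZr !memvZ // memv_span //; apply: allpairs_f;
    by rewrite mem_nth // size_tuple.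
by apply: pl; rewrite memv_cap e1_calH memv_ker (cosmash_counit Ae) (negPf i0) eqxx.
Qed.

Lemma cosmash_quot_iso : hopf_iso (hopf_quot (plus_ideal calH)) (group_alg k gT).
Proof.
apply: (surj_hopf_quot_iso cosmash_proj_morph lker_cosmash_proj cosmash_proj_surj).
Qed.

(** The series starts at [A] and does not stay there until the end. When it
    leaves [A] it falls into [calH], by [cosmash_normal_subalg], and the factor
    at that step maps onto k[gT] through [cosmash_proj]. *)
Lemma cosmash_not_solvable i0 b0 :
  prime #|cT| -> simple [set: gT] -> ~~ abelian [set: gT] -> T i0 b0 != b0 ->
  ~ lower_solvable A.
Proof.
move=> prc simG nab Tb0 [n [F [[[F0 Fn] Fsub Fnorm] Fcomm]]].
have line_calH : (<[1_A]> <= calH)%VS.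
  by rewrite -memvE -(bgelt_one Ae chiP) bgelt_calH.
have calH_proper : calH <> fullv.
  move=> HT; have := memvf (e b0 0); rewrite -HT => eH.
  have eu: ec b0 0 (e b0 0) = 0.
    have: forall x, x \in calH -> ec b0 0%R x = 0.
      apply: (span_ext (W := k^o)); [lin|by move=> a x y; rewrite scaler0 addr0|].
      move=> _ /mapP [g _ ->]; rewrite (ec_bgelt chi Ae); case: eqP => // b01.
      by move: Tb0; rewrite -b01 T1 eqxx.
    exact.
  by move/eqP: eu; rewrite dualE !eqxx (oner_eq0 k).
suff stays i : (i <= n)%N -> F i = fullv.
  apply: calH_proper; apply/eqP; rewrite eqEsubv subvf /=.
  by rewrite -(stays n (leqnn n)) Fn.
elim: i => [|i IH] ltin; first exact: F0.
have Fi := IH (ltnW ltin); have [_ nF] := Fnorm i ltin.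
have : normal_hopf_subalg (F i.+1).
  by split; [exact: Fsub|rewrite -Fi].
case/(cosmash_normal_subalg _ prc simG Tb0) => // FH; case/negP: nab;
  apply: (@group_alg_abelian k); apply: (factor_commutative (f := cosmash_proj) (K := F i.+1)).
- by have [[]] := cosmash_proj_morph.
- exact: cosmash_proj_surj.
- by move=> x; rewrite FH => /(subvP line_calH); exact: cosmash_proj_calH.
- by have := Fcomm i ltin; rewrite Fi.
- by have [[]] := cosmash_proj_morph.
- exact: cosmash_proj_surj.
- by move=> x; rewrite FH; exact: cosmash_proj_calH.
by have := Fcomm i ltin; rewrite Fi.
Qed.

Lemma cosmash_nontrivial i0 b0 :
  ~~ abelian [set: gT] -> T i0 b0 != b0 -> ~ trivial_hopf A.
Proof.
move=> nab Tb0 [] [X iso].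
  apply: (cosmash_noncocommutative Ae Tb0).
  exact: hopf_iso_cocommutative iso (@group_alg_cocommutative _ _).
apply: (cosmash_noncommutative Ae nab); apply: dual_cocommutative.
exact: hopf_iso_cocommutative iso (@group_alg_cocommutative _ _).
Qed.

End CosmashNormal.

(** * The biproduct *)

Section Idempotents.
Variables (k : fieldType) (cT : finGroupType) (I : finZmodType).
Variables (chi : cT -> I -> k) (psi : I -> cT -> k).
Hypothesis chiP : character_table chi psi.
Local Notation H := (group_alg k cT).

(** The primitive idempotents of k[cT], dual to the characters [fourier i]. *)
Definition idem i : H := \sum_g psi i g *: (gelt k g : H).

Definition fourier i : 'Hom(H, k^o) :=
  linfun (fun x : H => \sum_g ((x : {ffun cT -> k^o}) g : k) *: (chi g i : k^o)).

Lemma fourier_gelt i g : fourier i (gelt k g) = chi g i.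
Proof.
rewrite linfunE; last by lin.
under eq_bigr do rewrite ffunE; exact: sum_delta.
Qed.

Lemma fourier_idem i j : fourier i (idem j) = (j == i)%:R.
Proof.
rewrite linear_sum /=; under eq_bigr do rewrite linearZ /= fourier_gelt.
exact: (chi_psi chiP).
Qed.

Lemma fourier_sum (x : H) : x = \sum_i fourier i x *: idem i.
Proof.
move: x; apply: gelt_ext; [lin|lin|move=> g].
under eq_bigr do rewrite fourier_gelt /idem scaler_sumr.
rewrite exchange_big /=.
under eq_bigr do under eq_bigr do rewrite scalerA mulrC.
under eq_bigr => h _ do rewrite -scaler_suml (psi_chi chiP).
by rewrite sum_delta.
Qed.

Lemma idem_spanning : spanning idem.
Proof. by move=> x; exists (fun i => fourier i x); exact: fourier_sum. Qed.

Lemma fourier_mul i (x y : H) : fourier i (x ** y) = (fourier i x * fourier i y)%R.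
Proof.
move: x; apply: (gelt_ext (V := k^o)); [lin|lin|move=> g].
move: y; apply: (gelt_ext (V := k^o)); [lin|lin|move=> h].
by rewrite gelt_mul !fourier_gelt (chiM chiP).
Qed.

(** The characters [fourier l] are multiplicative and separate points. *)
Lemma idem_mul i j : idem i ** idem j = (i == j)%:R *: idem i.
Proof.
rewrite [LHS]fourier_sum [RHS]fourier_sum; apply: eq_bigr => l _; congr (_ *: _).
rewrite fourier_mul linearZ /= !fourier_idem.
have [->|ij] := eqVneq i j; first by rewrite scale1r -natrM mulnb andbb.
rewrite scale0r -natrM mulnb; case: (eqVneq i l) => // il.
by case: (eqVneq j l) => // jl; case/eqP: ij; rewrite il jl.
Qed.

Lemma idem_one : 1_H = \sum_i idem i.
Proof.
rewrite [LHS]fourier_sum; apply: eq_bigr => i _.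
by rewrite fourier_gelt (chi1 chiP) scale1r.
Qed.

Lemma idem_comul i : comul H (idem i) = \sum_a tens (idem a) (idem (i - a)).
Proof.
have -> : forall x, comul H x =
    \sum_a \sum_b fourier (a + b) x *: tens (idem a) (idem b).
  apply: gelt_ext; [lin|lin|move=> g]; rewrite gelt_comul.
  rewrite [gelt k g in LHS]fourier_sum tens_suml; apply: eq_bigr => a _.
  rewrite tens_sumr; apply: eq_bigr => b _.
  by rewrite tensZl tensZr scalerA !fourier_gelt (chiD chiP).
apply: eq_bigr => a _.
under eq_bigr => b _ do rewrite fourier_idem addrC -subr_eq eq_sym.
by rewrite sum_delta.
Qed.

Lemma idem_counit i : counit H (idem i) = (i == 0)%:R.
Proof.
rewrite -(fourier_idem 0 i); move: (idem i).
apply: (gelt_ext (V := k^o)); [lin|lin|move=> g].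
by rewrite gelt_counit fourier_gelt (chi0 chiP).
Qed.

Lemma idem_antipode i : antipode H (idem i) = idem (- i).
Proof.
have aE x j : fourier j (antipode H x) = fourier (- j) x.
  move: x; apply: (gelt_ext (V := k^o)); [lin|lin|move=> g].
  by rewrite gelt_antipode !fourier_gelt (chi_inv chiP).
rewrite [LHS]fourier_sum; under eq_bigr do rewrite aE fourier_idem eq_sym eqr_oppLR.
by rewrite sum_delta.
Qed.

Lemma idem_comm (x y : H) : x ** y = y ** x.
Proof.
by rewrite [x ** y]fourier_sum [y ** x]fourier_sum; apply: eq_bigr => i _;
  rewrite !fourier_mul mulrC.
Qed.

End Idempotents.

Section Biproduct.
Variables (k : fieldType) (gT cT : finGroupType) (I : finZmodType).
Variables (T : I -> gT -> gT) (chi : cT -> I -> k) (psi : I -> cT -> k).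
Hypothesis actT : autom_action T.
Hypothesis chiP : character_table chi psi.
Let T0 := autom0 actT.
Let TD := automD actT.
Let TM := automM actT.
Local Notation H := (group_alg k cT).
Local Notation B := (group_alg k gT).
Local Notation eps := (idem psi).
Local Notation ge b := (gelt k b : B).

Definition triv_act : 'Hom(tensor H B, B) :=
  tlift (fun (h : H) (b : B) => (counit H h : k) *: b).

(** This is the grading of k[gT] by the simultaneous eigenspaces of the action:
    it sends [v] to g (x) v if T_j v = chi g j v for all [j]. *)
Definition eigen_coact : 'Hom(B, tensor H B) :=
  linfun (fun a : B => \sum_b (a : {ffun gT -> k^o}) b *:
    \sum_j tens (eps j) (ge (T j b))).

Local Notation M := (YDData triv_act eigen_coact).

Lemma triv_actE (h : H) (b : B) : triv_act (tens h b) = (counit H h : k) *: b.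
Proof. by rewrite /triv_act tliftE; [|lin|lin]. Qed.

Lemma actE (h : H) (m : M) : h |> m = (counit H h : k) *: m.
Proof. exact: triv_actE. Qed.

Lemma eigen_coactE b : eigen_coact (ge b) = \sum_j tens (eps j) (ge (T j b)).
Proof.
rewrite linfunE; last by lin.
by under eq_bigr do rewrite ffunE; rewrite sum_delta.
Qed.

Lemma yd_module : yd_axioms M.
Proof.
have [_ _ _ [cM c1] _] := group_alg_hopf k cT.
split.
- split=> [h h' m|m]; rewrite !actE.
    by rewrite cM scalerA.
  by rewrite c1 scale1r.
- apply: gelt_ext; [lin|lin|move=> b]; rewrite eigen_coactE.
  rewrite sw_sum; [|lin|lin]; rewrite sw_sum; [|lin|lin].
  under eq_bigr => j _ do (rewrite (idem_comul chiP) sw_sum; [|lin|lin]).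
  under [RHS]eq_bigr => j _ do rewrite eigen_coactE tens_sumr.
  rewrite exchange_big /=; apply: eq_bigr => a _.
  rewrite (reindex_inj (addIr a)) /=; apply: eq_bigr => l _.
  by rewrite addrK TD.
- apply: gelt_ext; [lin|lin|move=> b]; rewrite eigen_coactE.
  rewrite sw_sum; [|lin|lin].
  under eq_bigr do rewrite (idem_counit chiP).
  by rewrite sum_delta T0.
move=> h m; move: h; apply: gelt_ext; [lin|lin|move=> g].
move: m; apply: gelt_ext; [lin|lin|move=> b].
rewrite gelt_comul tliftE; [|lin|lin]; rewrite tliftE; [|lin|lin].
rewrite actE gelt_counit scale1r eigen_coactE.
rewrite sw_sum; [|lin|lin]; rewrite sw_sum; [|lin|lin].
apply: eq_bigr => j _; rewrite actE gelt_counit scale1r.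
by congr tens; exact: (idem_comm chiP).
Qed.

Lemma tensor_actE (h : H) (t : yd_tensor M M) : h |> t = (counit H h : k) *: t.
Proof.
rewrite -[LHS]/(tlift _ _) tliftE; [|lin|lin].
move: h; apply: gelt_ext; [lin|lin|move=> g].
rewrite gelt_comul tliftE; [|lin|lin]; rewrite gelt_counit scale1r.
rewrite -[RHS]tlift_tens; apply: eq_tlift => b c.
by rewrite !actE gelt_counit !scale1r.
Qed.

Lemma tensor_coactE b c : ycoact (yd_tensor M M) (tens (ge b) (ge c)) =
  \sum_j tens (eps j) (tens (ge (T j b)) (ge (T j c))).
Proof.
rewrite -[LHS]/(tlift _ _) tliftE; [|lin|lin].
rewrite (eigen_coactE b) sw_sum; [|lin|lin]; apply: eq_bigr => j _.
rewrite eigen_coactE sw_sum; [|lin|lin].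
rewrite (bigD1 j) //= (idem_mul chiP) eqxx scale1r big1 ?addr0 // => l lj.
by rewrite (idem_mul chiP) eq_sym (negPf lj) scale0r tens0l.
Qed.

Lemma unit_actE (h : H) (c : k^o) : @Defs.act k H (yd_unit H) h c = counit H h * c.
Proof. by rewrite -[LHS]/(tlift _ _) tliftE; [|lin|lin]. Qed.

Lemma unit_coactE (c : k^o) : ycoact (yd_unit H) c = tens 1_H c.
Proof. by rewrite /= linfunE; [|lin]. Qed.

(** As [H] acts through its counit, the action of the coaction of [b] collapses
    to the term of index 0, which is [b] itself. Hence the braided
    multiplicativity of the coproduct is the ordinary one. *)
Lemma trivial_braiding (b c : B) : braiding M M (tens b c) = tens c b.
Proof.
rewrite tliftE; [|lin|lin].
move: b; apply: gelt_ext; [lin|lin|move=> b].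
rewrite eigen_coactE sw_sum; [|lin|lin].
under eq_bigr do rewrite actE (idem_counit chiP) tensZl.
by rewrite sum_delta T0.
Qed.

Lemma group_alg_yd_hopf : yd_hopf triv_act eigen_coact.
Proof.
have [algB coB [cM c1] couB antB] := group_alg_hopf k gT.
have unitE (c : k^o) : linfun (fun c : k^o => c *: 1_B) c = c *: 1_B.
  by apply: linfunE; lin.
split=> //; first exact: yd_module.
- split; split.
  + move=> h t; rewrite tensor_actE actE linearZ //.
  + apply: (tens_ext (@gelt_spanning k gT) (@gelt_spanning k gT)); [lin|lin|move=> b c].
    rewrite tensor_coactE sw_sum; [|lin|lin].
    rewrite -[hmul _ _]/(_ ** _) gelt_mul eigen_coactE; apply: eq_bigr => j _.
    by rewrite -[hmul _ _]/(_ ** _) gelt_mul TM.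
  + by move=> h c; rewrite unit_actE actE !unitE scalerA.
  + move=> c; rewrite unit_coactE tliftE; [|lin|lin].
    rewrite unitE linearZ /= eigen_coactE tensZr [X in tens X _](idem_one chiP) tens_suml.
    by congr (_ *: _); apply: eq_bigr => j _; rewrite (autom1 actT).
  + by move=> h m; rewrite tensor_actE actE linearZ.
  + apply: gelt_ext; [lin|lin|move=> b].
    rewrite gelt_comul tensor_coactE eigen_coactE sw_sum; [|lin|lin].
    by apply: eq_bigr => j _; rewrite gelt_comul.
  + by move=> h m; rewrite unit_actE actE linearZ.
  + apply: gelt_ext; [lin|lin|move=> b].
    rewrite gelt_counit unit_coactE eigen_coactE sw_sum; [|lin|lin].
    under [RHS]eq_bigr do rewrite gelt_counit.
    by rewrite -tens_suml -(idem_one chiP).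
  + by move=> h m; rewrite !actE linearZ.
  apply: gelt_ext; [lin|lin|move=> b].
  rewrite gelt_antipode !eigen_coactE sw_sum; [|lin|lin].
  by apply: eq_bigr => j _; rewrite gelt_antipode (automV actT).
split=> // x y; rewrite cM; apply: eq_tlift => x1 x2; apply: eq_tlift => y1 y2.
by rewrite trivial_braiding tliftE; [|lin|lin].
Qed.

Local Notation A := (biproduct triv_act eigen_coact).

Definition bip_basis b i : A := tens (ge b) (eps i).

Definition bip_coord b i : 'Hom(A, k^o) :=
  tlift (fun (u : B) (h : H) => ((u : {ffun gT -> k^o}) b : k) *: fourier chi i h).

Lemma bip_coord_basis b i c j : bip_coord b i (bip_basis c j) = ((c == b) && (j == i))%:R.
Proof.
rewrite /bip_coord tliftE; [|lin|lin]; rewrite (fourier_idem chiP) ffunE.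
by rewrite -mulnb natrM eq_sym.
Qed.

(** As the action is trivial, the product is the one of the tensor product of
    algebras. In the coproduct, the coaction of [b] contributes an idempotent
    eps_j multiplied by the first leg eps_a of the coproduct of eps_i, which
    leaves only j = a. *)
Lemma biproduct_cosmash_basis : cosmash_basis T bip_basis bip_coord.
Proof.
have mE (b c : B) (h h' : H) : (tens b h : A) ** tens c h' =
    \sw_(h1, h2 <- comul H h) tens (b ** triv_act (tens h1 c)) (h2 ** h').
  rewrite -[LHS]/(tlift _ _) tliftE; [|lin|lin].
  by rewrite tliftE; [|lin|lin]; rewrite tliftE; [|lin|lin].
have mul b i c j : bip_basis b i ** bip_basis c j = (i == j)%:R *: bip_basis (b * c)%g j.
  rewrite mE (idem_comul chiP) sw_sum; [|lin|lin].
  under eq_bigr do rewrite triv_actE (idem_counit chiP) prodZr tensZl.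
  rewrite sum_delta gelt_mul subr0 (idem_mul chiP) tensZr.
  by case: eqP => [->|]; rewrite ?scale0r.
have one b : tens (ge b) 1_H = \sum_i bip_basis b i.
  by rewrite [X in tens _ X](idem_one chiP) tens_sumr.
split.
- move=> x; move: x.
  apply: (tens_ext (@gelt_spanning k gT) (idem_spanning chiP)); [lin|lin|move=> c j].
  rewrite (bigD1 c) //= (bigD1 j) //= bip_coord_basis !eqxx scale1r.
  rewrite big1 ?addr0 => [|i /negPf ij]; last first.
    by rewrite bip_coord_basis eqxx eq_sym ij scale0r.
  rewrite big1 ?addr0 // => b /negPf bc; rewrite big1 // => i _.
  by rewrite bip_coord_basis eq_sym bc scale0r.
- exact: bip_coord_basis.
- exact: mul.
- exact: one.
- move=> b i; rewrite -[LHS]/(tlift _ _) tliftE; [|lin|lin].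
  rewrite gelt_comul tliftE; [|lin|lin].
  rewrite (idem_comul chiP) sw_sum; [|lin|lin]; apply: eq_bigr => a _.
  rewrite eigen_coactE sw_sum; [|lin|lin].
  under eq_bigr do rewrite (idem_mul chiP) tensZr tensZl.
  by rewrite sum_delta.
- move=> b i; rewrite -[LHS]/(tlift _ _) tliftE; [|lin|lin].
  by rewrite gelt_counit (idem_counit chiP) mul1r.
move=> b i; rewrite -[LHS]/(tlift _ _) tliftE; [|lin|lin].
rewrite eigen_coactE sw_sum; [|lin|lin].
rewrite (bigD1 i) //= big1 ?addr0 => [|j /negPf ji]; last first.
  by rewrite (idem_mul chiP) ji scale0r linear0 tens0r tens0l linear0.
rewrite (idem_mul chiP) eqxx scale1r (idem_antipode chiP) gelt_antipode.
rewrite -[LHS]/((bip_basis 1%g (- i) : A) ** (tens (ge (T i b)^-1%g) 1_H : A)).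
rewrite one prod_sumr; under eq_bigr do rewrite mul mul1g eq_sym.
by rewrite sum_delta.
Qed.

Lemma bip_basis_bgelt g : bgelt bip_basis chi 1%g g = tens (ge 1%g) (gelt k g : H).
Proof.
rewrite /bgelt [gelt k g in RHS](fourier_sum chiP) tens_sumr.
by apply: eq_bigr => i _; rewrite tensZr fourier_gelt.
Qed.

End Biproduct.

(** * Automorphisms of prime order and roots of unity *)

Section CyclicCharacters.
Variables (k : fieldType) (p : nat) (z : k).
Hypothesis pr_p : prime p.
Hypothesis prim_z : p.-primitive_root z.

Let p_gt1 : (1 < p)%N := prime_gt1 pr_p.

Definition zeta (x : 'Z_p) : k := z ^+ x.

Lemma zetaD x y : zeta (x + y) = zeta x * zeta y.
Proof.
rewrite /zeta -exprD /= [X in (_ %% X)%N]Zp_cast //.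
by rewrite (prim_expr_mod prim_z).
Qed.

Lemma zeta_eq1 x : (zeta x == 1) = (x == 0).
Proof.
rewrite /zeta -(expr0 z) (eq_prim_root_expr prim_z) mod0n modn_small //.
by have := ltn_ord x; rewrite {2}Zp_cast.
Qed.

(** Translating the summation index multiplies the sum by [zeta d], which
    differs from 1 if [d] is nonzero. *)
Lemma sum_zeta d : \sum_(x : 'Z_p) zeta (x * d) = if d == 0 then p%:R else 0.
Proof.
case: (eqVneq d 0) => [->|d0].
  under eq_bigr do rewrite mulr0.
  by rewrite sumr_const card_ord Zp_cast.
apply/eqP; set S := \sum_x _; have : S * (zeta d - 1) == 0.
  rewrite mulrBr mulr1 subr_eq0 {2}/S (reindex_inj (addIr 1)) /= mulr_suml.
  by apply/eqP/eq_bigr => x _; rewrite mulrDl mul1r zetaD.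
by rewrite mulf_eq0 subr_eq0 zeta_eq1 (negPf d0) orbF.
Qed.

Lemma cyclic_character_table :
  @character_table k ('Z_p : finGroupType) ('Z_p : finZmodType) (fun g i => zeta (g * i))
    (fun i g => p%:R^-1 * zeta (- (i * g))).
Proof.
have pk : p%:R != 0 :> k := prim_root_natf_neq0 prim_z.
split.
- by move=> g; rewrite mulr0.
- by move=> g i j; rewrite mulrDr zetaD.
- by move=> i; rewrite -[1%g]/(0 : 'Z_p) mul0r.
- by move=> g h i; rewrite -[(g * h)%g]/(g + h) mulrDl zetaD.
- move=> i j.
  under eq_bigr => g _ do rewrite -mulrA -zetaD [i * g]mulrC -mulrN -mulrDr.
  rewrite -mulr_sumr sum_zeta addrC subr_eq0 eq_sym.
  by case: eqP; rewrite ?mulr0 // mulVf.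
move=> g h.
under eq_bigr => i _ do rewrite -mulrA -zetaD [h * i]mulrC -mulrN -mulrDr.
rewrite -mulr_sumr sum_zeta addrC subr_eq0 eq_sym.
by case: eqP; rewrite ?mulr0 // mulVf.
Qed.

End CyclicCharacters.

Section PrimeOrderAutomorphism.
Variables (gT : finGroupType) (theta : {perm gT}) (p : nat).
Hypothesis pr_p : prime p.
Hypothesis theta_aut : theta \in Aut [set: gT].
Hypothesis ord_theta : #[theta]%g = p.

Let p_gt1 : (1 < p)%N := prime_gt1 pr_p.

Definition iter_aut (i : 'Z_p) (b : gT) : gT := (theta ^+ i)%g b.

Lemma iter_aut0 b : iter_aut 0 b = b.
Proof. by rewrite /iter_aut expg0 perm1. Qed.

Lemma iter_autD i j b : iter_aut (i + j) b = iter_aut i (iter_aut j b).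
Proof.
rewrite /iter_aut -permM -expgD addnC /= [X in (_ %% X)%N]Zp_cast //.
by rewrite -[in RHS]expg_mod_order ord_theta.
Qed.

Lemma iter_autM i b c : iter_aut i (b * c)%g = (iter_aut i b * iter_aut i c)%g.
Proof.
have aX : (theta ^+ i)%g \in Aut [set: gT] by rewrite groupX.
by rewrite /iter_aut (morphicP (Aut_morphic aX)) ?inE.
Qed.

Lemma iter_aut_action : autom_action iter_aut.
Proof. by split; [exact: iter_aut0|exact: iter_autD|exact: iter_autM]. Qed.

(** A nontrivial power of [theta] generates the same group as [theta], since
    the order is prime. *)
Lemma iter_aut_semireg (i : 'Z_p) b :
  i != 0 -> iter_aut i b = b -> forall j, iter_aut j b = b.
Proof.
move=> i0 bi j; have cop : coprime #[theta]%g i.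
  rewrite ord_theta prime_coprime // gtnNdvd ?lt0n //.
  by have := ltn_ord i; rewrite {2}Zp_cast.
have : (theta ^+ j)%g \in <[theta ^+ i]>%g.
  move: cop; rewrite -generator_coprime => /eqP <-; exact: mem_cycle.
case/cycleP => m mE; rewrite /iter_aut mE permX.
by elim: m {mE} => //= m ->.
Qed.

Lemma iter_aut_moved : exists b, iter_aut 1 b != b.
Proof.
apply/existsP; apply: contraLR p_gt1; rewrite negb_exists => /forallP fixb.
suff t1 : theta = 1%g by rewrite -ord_theta t1 order1.
by apply/permP => b; rewrite perm1; apply/eqP; have := fixb b; rewrite negbK.
Qed.

End PrimeOrderAutomorphism.

Theorem theorem6 (k : fieldType) (gT : finGroupType) (theta : {perm gT})
    (p : nat) :
  simple [set: gT] -> ~~ abelian [set: gT] ->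
  theta \in Aut [set: gT] -> prime p -> #[theta]%g = p ->
  (exists z : k, p.-primitive_root z) ->
  exists (cT : finGroupType),
    [/\ cyclic [set: cT], #|[set: cT]| = p &
    exists (yact : 'Hom(tensor (group_alg k cT) (group_alg k gT),
                        group_alg k gT))
           (ycoact : 'Hom(group_alg k gT,
                          tensor (group_alg k cT) (group_alg k gT))),
      yd_hopf yact ycoact /\
      let A := biproduct yact ycoact in
      let calH : {vspace A} :=
        <<[seq tens (hone (group_alg k gT)) (gelt k g : group_alg k cT)
             | g <- enum cT]>>%VS in
      [/\ hopf_axioms A,
          [/\ ~ trivial_hopf A,
              #|[set: gT]|%:R != 0 :> k -> semisimple A &
              cosemisimple A],
          forall K : {vspace A}, normal_hopf_subalg K <->
            [\/ K = <[hone A]>%VS, K = calH | K = fullv] &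
          [/\ hopf_iso (hopf_sub calH) (group_alg k cT),
              hopf_iso (hopf_quot (plus_ideal calH)) (group_alg k gT) &
              ~ lower_solvable A]]].
Proof.
move=> simG nabG theta_aut pr_p ord_theta [z prim_z].
have p_gt1 := prime_gt1 pr_p.
have chiP := cyclic_character_table pr_p prim_z.
have actT := iter_aut_action pr_p theta_aut ord_theta.
have Tsr := iter_aut_semireg pr_p ord_theta.
have [b0 Tb0] := iter_aut_moved pr_p ord_theta.
have pZ : #|'Z_p| = p by rewrite card_ord Zp_cast.
have pr_Z : prime #|'Z_p| by rewrite pZ.
have Ae := biproduct_cosmash_basis (iter_aut theta (p := p)) chiP.
exists 'Z_p; split; [|by rewrite cardsT|].
  by rewrite Zp_cycle cycle_cyclic.
eexists; eexists; split; first exact: (group_alg_yd_hopf actT chiP).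
move=> A HH; pose chi (g i : 'Z_p) := zeta z (g * i).
have {HH}-> : HH = calH (bip_basis (iter_aut theta (p := p)) _) chi.
  by congr (span _); apply: eq_map => g; exact/esym/(bip_basis_bgelt _ chiP).
split.
- exact: cosmash_hopf Ae actT.
- split.
  + exact (cosmash_nontrivial Ae nabG Tb0).
  + exact: cosmash_separable Ae.
  + exact: cosmash_cosemisimple Ae actT Tsr chiP.
- move=> K; exact: (cosmash_normal_subalg Ae actT Tsr chiP K pr_Z simG Tb0).
split.
- exact: calH_iso Ae actT chiP.
- exact: cosmash_quot_iso Ae actT chiP.
exact (cosmash_not_solvable Ae actT Tsr chiP pr_Z simG nabG Tb0).
Qed.
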